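(* Let $A$ be a finite subset of an abelian group $G$, and let $n>0$ be a real number such that $A$ cannot be covered by fewer than $n$ cosets of a finite subgroup of $G$ (that is, whenever $K\le G$ is a finite subgroup and $A$ is contained in a union of $m$ cosets of $K$, we have $m\ge n$). If $|2A|<3\big(1-\frac1n\big)|A|$, then there exist an arithmetic progression $P\subseteq G$ with $|P|\ge 3$ and a finite subgroup $K\le G$ such that $|P+K|=|P||K|$, $A\subseteq P+K$, and $(|P|-1)|K|\le|2A|-|A|$.
   Context: For subsets $X,Y$ of an additively written abelian group, $X+Y=\{x+y\colon x\in X,\ y\in Y\}$ and $2X=X+X$. An arithmetic progression in $G$ is a set of the form $\{c+jd\colon j=0,1,\dots,N\}$ with $c,d\in G$ and $N\ge 0$ an integer; $|P|$ denotes its number of elements. *)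

(* Defs.v *)
(* MathComp world; the real numbers are an arbitrary [realType]. *)
From mathcomp Require Import all_boot all_order all_algebra.
From mathcomp Require Import finmap.
From mathcomp Require Import reals.

Set Implicit Arguments.
Unset Strict Implicit.
Unset Printing Implicit Defensive.

Import Order.TTheory GRing.Theory Num.Theory.

Local Open Scope fset_scope.
Local Open Scope ring_scope.

Definition sumset (G : zmodType) (X Y : {fset G}) : {fset G} :=
  [fset x + y | x in X, y in Y].

Definition is_subgroup (G : zmodType) (K : {fset G}) : Prop :=
  zmod_closed [in K].

Definition add_coset (G : zmodType) (g : G) (K : {fset G}) : {fset G} :=
  [fset g + k | k in K].

(* The cosets [add_coset (g i) K] may repeat, so this reads "at most m cosets";
   when m = 0 it says that A is empty. *)
Definition covered_by_cosets (G : zmodType) (A K : {fset G}) (m : nat) : Prop :=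
  exists g : 'I_m -> G, forall a, a \in A -> exists i, a \in add_coset (g i) K.

(* The terms may repeat when d has finite order: N.+1 is not the cardinality. *)
Definition is_arith_prog (G : zmodType) (P : {fset G}) : Prop :=
  exists (c d : G) (N : nat), P = [fset c + d *+ j | j in iota 0 N.+1].

(* Main.v *)
From HB Require Import structures.
Require Import Defs.
From mathcomp Require Import all_boot all_order all_algebra.
From mathcomp Require Import finmap.
From mathcomp Require Import reals.
From mathcomp Require Import boolp zify ring.

(* A homomorphism lam from the span of A to the integers, killing no difference
   of elements of A of infinite order, splits A into m levels, and n <= m since
   each level lies in a coset of a finite subgroup. Let d be the difference of
   an element of the top level and one of the bottom level. Every class modulo d
   of a0 + A carries two elements of 2A, so |2A| >= |2A mod d| + |A|, and
   Kneser's theorem modulo d gives a finite group H of periods of 2A mod d with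
   |2A mod d| >= 2 |A + H mod d| - |H|.
     If A lies in one class of H, then the preimage of H is cyclic modulo its
   torsion subgroup K, and A is contained in P + K with
   (|P| - 1) |K| <= |H| <= |2A| - |A|.
     Otherwise 2A mod d meets a class of H outside a0 + A, over which 2A has more
   than |H| elements. When no further class of A reaches both the bottom and the
   top level, the surplus comes from an inequality for sumsets C + D in an
   extension of the integers by K; when one does, from translating a class by
   two elements whose difference has level lam d. Either way
   |2A| >= 3 (1 - 1/m) |A|, which is excluded. *)

Set Implicit Arguments.
Unset Strict Implicit.
Unset Printing Implicit Defensive.

Import Order.TTheory GRing.Theory Num.Theory.

Local Open Scope fset_scope.
Local Open Scope ring_scope.

(** * Sumsets and periods *)

Notation "X :+: Y" := (sumset X Y) (at level 50, left associativity).

(* Abstracting the cardinals first keeps [lia] from unfolding them. *)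
Ltac card_lia :=
  repeat match goal with
  | H : is_true (leq _ _) |- _ => revert H
  | H : @eq nat _ _ |- _ => revert H
  | H : not (is_true (leq _ _)) |- _ => revert H
  | H : is_true (negb (leq _ _)) |- _ => revert H
  end;
  repeat match goal with
  | |- context [@size ?T (@enum_fset ?U ?X)] =>
    let n := fresh in set n := (@size T (@enum_fset U X)); move: n => ?
  end;
  clear; intros; lia.

Section Sumsets.
Variable G : zmodType.
Implicit Types (X Y Z K : {fset G}) (x y z g : G).

Lemma sumsetP X Y z :
  reflect (exists x y, [/\ x \in X, y \in Y & z = x + y]) (z \in X :+: Y).
Proof.
apply: (iffP (imfset2P _ _ _ _ _)) => [[x /= xX [y /= yY ->]]|[x [y [xX yY ->]]]].
  by exists x, y.
by exists x => //; exists y.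
Qed.

Lemma mem_sumset X Y x y : x \in X -> y \in Y -> x + y \in X :+: Y.
Proof. by move=> xX yY; apply/sumsetP; exists x, y. Qed.

Lemma sumsetC X Y : X :+: Y = Y :+: X.
Proof.
by apply/fsetP=> z; apply/sumsetP/sumsetP=> -[x [y [? ? ->]]]; exists y, x; rewrite addrC.
Qed.

Lemma sumsetA X Y Z : X :+: (Y :+: Z) = X :+: Y :+: Z.
Proof.
apply/fsetP=> z; apply/sumsetP/sumsetP.
  move=> [x [_ [xX /sumsetP[y [w [yY wZ ->]]] ->]]].
  by exists (x + y), w; rewrite mem_sumset ?addrA.
move=> [_ [w [/sumsetP[x [y [xX yY ->]]] wZ ->]]].
by exists x, (y + w); rewrite mem_sumset ?addrA.
Qed.

Lemma sumsetS X X' Y Y' : X `<=` X' -> Y `<=` Y' -> X :+: Y `<=` X' :+: Y'.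
Proof.
move=> /fsubsetP sX /fsubsetP sY; apply/fsubsetP=> _ /sumsetP[x [y [xX yY ->]]].
by rewrite mem_sumset ?sX ?sY.
Qed.

Lemma mem_coset g X x : (x \in add_coset g X) = (x - g \in X).
Proof.
apply/imfsetP/idP => [[k /= kX ->]|xX]; first by rewrite addrC addKr.
by exists (x - g); rewrite //= addrC subrK.
Qed.

Lemma card_coset g X : #|` add_coset g X| = #|` X|.
Proof. by rewrite card_imfset //; apply: addrI. Qed.

Lemma coset_sumset g X Y : add_coset g X :+: Y = add_coset g (X :+: Y).
Proof.
apply/fsetP=> z; rewrite mem_coset; apply/sumsetP/sumsetP.
  move=> [x [y [+ yY ->]]]; rewrite mem_coset => xX.
  by exists (x - g), y; rewrite addrAC.
move=> [x [y [xX yY E]]]; exists (g + x), y.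
by rewrite mem_coset [g + x]addrC addrK -addrA [g + y]addrC addrA -E subrK.
Qed.

Lemma card_sumset_ge X Y : X != fset0 -> (#|` Y| <= #|` X :+: Y|)%N.
Proof.
move=> /fset0Pn[x xX]; rewrite -(card_coset x); apply: fsubset_leq_card.
by apply/fsubsetP=> z; rewrite mem_coset => zY; rewrite -(subrK x z) addrC mem_sumset.
Qed.

Lemma sumset_neq0 X Y : X != fset0 -> Y != fset0 -> X :+: Y != fset0.
Proof.
by move=> /fset0Pn[x xX] /fset0Pn[y yY]; apply/fset0Pn; exists (x + y); rewrite mem_sumset.
Qed.

Lemma neq0_sumset X Y : X :+: Y != fset0 -> X != fset0 /\ Y != fset0.
Proof.
by move=> /fset0Pn[_ /sumsetP[x [y [? ? _]]]]; split; apply/fset0Pn; [exists x|exists y].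
Qed.

Lemma card_disjU X Y : (forall z, z \in X -> z \in Y -> False) ->
  #|` X `|` Y| = (#|` X| + #|` Y|)%N.
Proof.
move=> dXY; rewrite -cardfsUI; suff -> : X `&` Y = fset0 by rewrite cardfs0 addn0.
by apply/fsetP=> z; rewrite !inE; apply/negP=> /andP[/dXY].
Qed.

Lemma cardfsU_le X Y : (#|` X `|` Y| <= #|` X| + #|` Y|)%N.
Proof. by rewrite -cardfsUI leq_addr. Qed.

End Sumsets.

(** * Finite subgroups, periods and stabilizers *)

Section Subgroups.
Variable G : zmodType.
Implicit Types (X Y K : {fset G}) (x y g : G).

Lemma sg0 K : is_subgroup K -> 0 \in K.
Proof. by case. Qed.

Lemma sgB K x y : is_subgroup K -> x \in K -> y \in K -> x - y \in K.
Proof. by case=> _; apply. Qed.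

Lemma sgN K x : is_subgroup K -> x \in K -> - x \in K.
Proof. by move=> sK xK; rewrite -sub0r sgB ?sg0. Qed.

Lemma sgD K x y : is_subgroup K -> x \in K -> y \in K -> x + y \in K.
Proof. by move=> sK xK yK; rewrite -[y]opprK sgB ?sgN. Qed.

Lemma sgBC K x y : is_subgroup K -> (x - y \in K) = (y - x \in K).
Proof. by move=> sK; apply/idP/idP=> /(sgN sK); rewrite opprB. Qed.

Lemma sg_trans K y x z : is_subgroup K -> x - y \in K -> y - z \in K -> x - z \in K.
Proof. by move=> sK xy yz; rewrite -(subrK y x) -addrA sgD. Qed.

Lemma sg_gt0 K : is_subgroup K -> (0 < #|` K|)%N.
Proof. by move=> sK; rewrite cardfs_gt0; apply/fset0Pn; exists 0; apply: sg0. Qed.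

Lemma mem_sumK X K x : reflect (exists2 y, y \in X & x - y \in K) (x \in X :+: K).
Proof.
apply: (iffP (sumsetP _ _ _)) => [[y [k [yX kK ->]]]|[y yX xy]].
  by exists y; rewrite // addrC addrA addNr add0r.
by exists y, (x - y); split; rewrite // addrC subrK.
Qed.

Lemma sub_sumK X K : is_subgroup K -> X `<=` X :+: K.
Proof. by move=> sK; apply/fsubsetP=> x xX; apply/mem_sumK; exists x; rewrite ?subrr ?sg0. Qed.

Lemma sumKK K : is_subgroup K -> K :+: K = K.
Proof.
move=> sK; apply/eqP; rewrite eqEfsubset sub_sumK // andbT.
by apply/fsubsetP=> _ /sumsetP[x [y [xK yK ->]]]; rewrite sgD.
Qed.

Lemma sumsetKK X K : is_subgroup K -> X :+: K :+: K = X :+: K.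
Proof. by move=> sK; rewrite -sumsetA sumKK. Qed.

Lemma sumK_sub K K' : is_subgroup K' -> K `<=` K' -> K' :+: K `<=` K'.
Proof. by move=> sK' KK'; rewrite -[X in _ `<=` X](sumKK sK') sumsetS. Qed.

Lemma sumKK_sub X K K' : is_subgroup K -> is_subgroup K' -> K `<=` K' ->
  X :+: K' :+: K = X :+: K'.
Proof.
move=> sK sK' KK'; rewrite -sumsetA; congr (_ :+: _); apply/eqP.
by rewrite eqEfsubset sub_sumK ?andbT ?sumK_sub.
Qed.

Lemma period_sub X K K' : is_subgroup K -> is_subgroup K' -> K `<=` K' ->
  X :+: K' = X -> X :+: K = X.
Proof. by move=> sK sK' KK' <-; apply: sumKK_sub. Qed.

Lemma period_mem X K x y : X :+: K = X -> x \in X -> y - x \in K -> y \in X.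
Proof. by move=> XK xX yx; rewrite -XK; apply/mem_sumK; exists x. Qed.

Lemma sub_period X Y K : X `<=` Y -> Y :+: K = Y -> X :+: K `<=` Y.
Proof. by move=> XY <-; apply: sumsetS. Qed.

(** Removing from [X] a coset of [K] that it contains leaves a [K]-periodic set; induction on the
    cardinality. *)
Lemma dvdn_period K X : is_subgroup K -> X :+: K = X -> (#|` K| %| #|` X|)%N.
Proof.
move=> sK; have [n] := ubnP #|` X|; elim: n X => // n IHn X ltXn XK.
have [->|/fset0Pn[x xX]] := eqVneq X fset0; first by rewrite cardfs0 dvdn0.
have sxK : add_coset x K `<=` X.
  by apply/fsubsetP=> y; rewrite mem_coset; apply: period_mem xX.
rewrite -(cardfsID (add_coset x K) X) (fsetIidPr sxK) card_coset dvdn_addr //.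
apply: IHn.
  rewrite (leq_trans _ (_ : #|` X| <= n)%N) //.
  rewrite cardfsDS // card_coset ltn_subrL sg_gt0 //=.
  by rewrite cardfs_gt0; apply/fset0Pn; exists x.
apply/eqP; rewrite eqEfsubset sub_sumK // andbT; apply/fsubsetP=> z /mem_sumK[y].
rewrite !inE !mem_coset => /andP[yx yX] zy; rewrite (period_mem XK yX zy) andbT.
by apply: contra yx => zx; rewrite (sg_trans (y := z)) // sgBC.
Qed.

Lemma dvdn_sumK K K' X : is_subgroup K -> is_subgroup K' -> K `<=` K' ->
  (#|` K| %| #|` X :+: K'|)%N.
Proof. by move=> sK sK' KK'; apply: dvdn_period => //; apply: sumKK_sub. Qed.

(** A period of a nonempty [X] is a difference of two of its elements, so this filter yields the
    whole stabilizer as a finite set. For empty [X] it is empty, hence the hypotheses [X != fset0]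
    below. *)
Definition stab X : {fset G} :=
  [fset g in [fset x - y | x in X, y in X] | add_coset g X == X].

Lemma mem_stab X g : X != fset0 -> (g \in stab X) = (add_coset g X == X).
Proof.
move=> /fset0Pn[x xX]; rewrite !inE; case: eqP => [E|]; rewrite ?andbF // andbT.
apply/imfset2P; exists (g + x) => /=; first by rewrite -E mem_coset addrC addKr.
by exists x; rewrite //= addrK.
Qed.

Lemma stabP X g : X != fset0 ->
  reflect (forall x, x \in X -> g + x \in X) (g \in stab X).
Proof.
move=> X0; rewrite mem_stab //; apply: (iffP eqP) => [E x xX|gX].
  by rewrite -E mem_coset addrC addKr.
apply/eqP; rewrite eqEfcard card_coset leqnn andbT; apply/fsubsetP=> x.
by rewrite mem_coset => /gX; rewrite addrC subrK.
Qed.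

Lemma stab_sg X : X != fset0 -> is_subgroup (stab X).
Proof.
move=> X0; split; first by apply/stabP => // x; rewrite add0r.
move=> g h; rewrite !mem_stab // => /eqP gX /eqP hX; apply/eqP.
apply/fsetP=> x; rewrite mem_coset opprB addrA -mem_coset gX.
by rewrite -[in LHS]hX mem_coset addrK.
Qed.

Lemma stab_period X : X != fset0 -> X :+: stab X = X.
Proof.
move=> X0; apply/eqP; rewrite eqEfsubset (sub_sumK _ (stab_sg X0)) andbT.
apply/fsubsetP=> x /mem_sumK[y yX /(stabP _ X0)/(_ _ yX)].
by rewrite subrK.
Qed.

Lemma sub_stab X K : X != fset0 -> X :+: K = X -> K `<=` stab X.
Proof.
move=> X0 XK; apply/fsubsetP=> k kK; apply/stabP => // x xX.
by rewrite -XK addrC mem_sumset.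
Qed.

Lemma stab_coset g X : X != fset0 -> stab (add_coset g X) = stab X.
Proof.
move=> X0; have gX0 : add_coset g X != fset0.
  by rewrite -cardfs_gt0 card_coset cardfs_gt0.
apply/fsetP=> h; rewrite !mem_stab //; apply/eqP/eqP=> E; apply/fsetP=> x.
  move/fsetP/(_ (g + x)): E; rewrite !mem_coset.
  by rewrite addrAC [g + x]addrC !addrK.
by rewrite !mem_coset addrAC -[_ - h \in X]mem_coset E.
Qed.

End Subgroups.

(** * Kneser's theorem *)

Section CosetParts.
Variable G : zmodType.
Implicit Types (X Y K H : {fset G}) (x y g a : G).

Lemma sumsetUl X Y K : (X `|` Y) :+: K = (X :+: K) `|` (Y :+: K).
Proof.
apply/fsetP=> z; rewrite inE; apply/sumsetP/orP.
  move=> [x [k [+ kK ->]]]; rewrite inE => /orP[] xX; [left|right]; exact: mem_sumset.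
by move=> [] /sumsetP[x [k [xX kK ->]]]; exists x, k; rewrite inE xX ?orbT.
Qed.

Definition part H X a : {fset G} := [fset x in X | x - a \in H].

Lemma in_part H X a x : (x \in part H X a) = (x \in X) && (x - a \in H).
Proof. by rewrite !inE. Qed.

Lemma part_sub H X a : part H X a `<=` X.
Proof. by apply/fsubsetP=> x; rewrite in_part => /andP[]. Qed.

Lemma partU H X Y a : part H (X `|` Y) a = part H X a `|` part H Y a.
Proof. by apply/fsetP=> x; rewrite !(in_part, inE) andb_orl. Qed.

Lemma card_partU H X Y K a :
  (#|` part H (X `|` Y) a :+: K| <= #|` part H X a :+: K| + #|` part H Y a :+: K|)%N.
Proof. by rewrite partU sumsetUl -cardfsUI leq_addr. Qed.

Lemma part_eq H X a b : is_subgroup H -> a - b \in H -> part H X a = part H X b.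
Proof.
move=> sH ab; apply/fsetP=> x; rewrite !in_part; case: (x \in X) => //=.
by apply/idP/idP=> xa; [apply: (sg_trans sH xa)|apply: (sg_trans sH xa); rewrite sgBC].
Qed.

Lemma part_period H K X a : is_subgroup H -> is_subgroup K -> K `<=` H -> X :+: K = X ->
  part H X a :+: K = part H X a.
Proof.
move=> sH sK /fsubsetP KH XK; apply/eqP; rewrite eqEfsubset (sub_sumK _ sK) andbT.
apply/fsubsetP=> x /mem_sumK[y]; rewrite !in_part => /andP[yX ya] xy.
by rewrite (period_mem XK yX xy) (sg_trans sH (KH _ xy) ya).
Qed.

(** Inclusion-exclusion: [X + K] and the coset [a + H] both lie in [X + H], and they meet inside
    [part H X a + K]. *)
Lemma part_gap H K X a : is_subgroup H -> is_subgroup K -> K `<=` H -> a \in X ->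
  (#|` X :+: K| + #|` H| <= #|` X :+: H| + #|` part H X a :+: K|)%N.
Proof.
move=> sH sK /fsubsetP KH aX; rewrite -(card_coset a H) -cardfsUI leq_add //.
  apply: fsubset_leq_card; rewrite fsubUset sumsetS //=; last exact/fsubsetP.
  by apply/fsubsetP=> x; rewrite mem_coset => xa; apply/mem_sumK; exists a.
apply: fsubset_leq_card; apply/fsubsetP=> x; rewrite inE mem_coset => /andP[].
move=> /mem_sumK[y yX xy] xa; apply/mem_sumK; exists y => //.
by rewrite in_part yX (sg_trans sH (y := x)) // sgBC // KH.
Qed.

(** The same count with trivial [K], for two distinct cosets at once. *)
Lemma part_gap2 H X a b : is_subgroup H -> a \in X -> b \in X -> a - b \notin H ->
  (#|` X| + 2 * #|` H| <= #|` X :+: H| + #|` part H X a| + #|` part H X b|)%N.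
Proof.
move=> sH aX bX abH.
have dj : forall z, z \in add_coset a H -> z \in add_coset b H -> False.
  move=> z; rewrite !mem_coset => za zb; move/negP: abH; apply.
  by apply: (sg_trans sH (y := z)); rewrite // sgBC.
have <- : #|` add_coset a H `|` add_coset b H| = (2 * #|` H|)%N.
  by rewrite card_disjU // !card_coset mul2n addnn.
rewrite -cardfsUI -addnA leq_add //.
  apply: fsubset_leq_card; rewrite !fsubUset (sub_sumK _ sH) /=.
  by apply/andP; split; apply/fsubsetP=> x; rewrite mem_coset => xa; apply/mem_sumK;
    [exists a|exists b].
apply: (@leq_trans #|` part H X a `|` part H X b|); last by rewrite -cardfsUI leq_addr.
apply: fsubset_leq_card; apply/fsubsetP=> x.
by rewrite !(inE, in_part, mem_coset) => /andP[-> /orP[] ->]; rewrite ?orbT.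
Qed.

End CosetParts.

(** The conclusion of Kneser's theorem, with the subtracted [|H|] moved across to avoid truncated
    subtraction. *)
Definition kneser_bound (G : zmodType) (X Y : {fset G}) : Prop :=
  (#|` X :+: stab (X :+: Y)| + #|` Y :+: stab (X :+: Y)|
     <= #|` X :+: Y| + #|` stab (X :+: Y)|)%N.

(** * The inductive step of Kneser's theorem *)

Section KneserStep.
Variable G : zmodType.
Variables A B : {fset G}.
Let S := A :+: B.
Let H0 := stab S.
Let I := A `&` B.
Let U := A `|` B.

Hypothesis I_neq0 : I != fset0.
Hypothesis I_lt : (#|` I| < #|` A|)%N.
Hypothesis AH0 : A :+: H0 = A.
Hypothesis BH0 : B :+: H0 = B.
Hypothesis IH_card : forall X Y : {fset G}, X != fset0 -> Y != fset0 ->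
  (#|` X :+: Y| < #|` S|)%N -> kneser_bound X Y.
Hypothesis IH_left : forall X Y : {fset G}, X != fset0 -> Y != fset0 ->
  #|` X :+: Y| = #|` S| -> (#|` X| + #|` Y|)%N = (#|` A| + #|` B|)%N ->
  (#|` X| < #|` A|)%N -> kneser_bound X Y.

Let A_neq0 : A != fset0.
Proof. by have /fset0Pn[x] := I_neq0; rewrite inE => /andP[xA _]; apply/fset0Pn; exists x. Qed.

Let B_neq0 : B != fset0.
Proof. by have /fset0Pn[x] := I_neq0; rewrite inE => /andP[_ xB]; apply/fset0Pn; exists x. Qed.

Let S_neq0 : S != fset0.
Proof. exact: sumset_neq0. Qed.

Let sH0 : is_subgroup H0.
Proof. exact: stab_sg. Qed.

Let U_neq0 : U != fset0.
Proof. by have /fset0Pn[x xA] := A_neq0; apply/fset0Pn; exists x; rewrite inE xA. Qed.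

Let AU : A `<=` U. Proof. exact: fsubsetUl. Qed.
Let BU : B `<=` U. Proof. exact: fsubsetUr. Qed.

(* A convergent in DeVos's proof of Kneser's theorem, the stabilizer of C being
   replaced by any subgroup of periods. Working above H0 avoids passing to the
   quotient by the stabilizer of A + B. *)
Definition convergent (C H : {fset G}) : Prop :=
  [/\ is_subgroup H, H0 `<=` H, C != fset0, C :+: H = C & C `<=` S]
  /\ (#|` I| + #|` U :+: H| <= #|` C| + #|` H|)%N.

(** The sumset [I + U] lies in [S], and Kneser's bound makes it a convergent. That bound holds by
    induction: either [I + U] is smaller than [S], or the sizes agree, [|I| + |U| = |A| + |B|] and
    [I] is smaller than [A]. *)
Lemma convergent_exists : exists C H, convergent C H.
Proof.
have C0 : I :+: U != fset0 by apply: sumset_neq0.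
have CS : I :+: U `<=` S.
  apply/fsubsetP=> _ /sumsetP[x [y [+ + ->]]]; rewrite !inE => /andP[xA xB] /orP[] yA.
    by rewrite addrC mem_sumset.
  exact: mem_sumset.
have IH0 : I :+: H0 = I.
  apply/eqP; rewrite eqEfsubset (sub_sumK _ sH0) andbT fsubsetI.
  by rewrite !sub_period ?fsubsetIl ?fsubsetIr.
exists (I :+: U), (stab (I :+: U)); split; first split.
- exact: stab_sg.
- by apply: sub_stab => //; rewrite -sumsetA [U :+: _]sumsetC sumsetA IH0.
- by [].
- exact: stab_period.
- by [].
have : kneser_bound I U.
  have := fsubset_leq_card CS; rewrite leq_eqVlt => /orP[/eqP E|]; last exact: IH_card.
  by apply: IH_left; rewrite // addnC cardfsUI.
rewrite /kneser_bound; apply: leq_trans; rewrite leq_add2r.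
exact: fsubset_leq_card (sub_sumK _ (stab_sg C0)).
Qed.

Section Local.
Variables C H : {fset G}.
Hypothesis CH : convergent C H.
Hypothesis minH : forall C' H', convergent C' H' -> (#|` H| <= #|` H'|)%N.
Variable c : G.
Hypothesis cS : c \notin S.

Let sH : is_subgroup H. Proof. by case: CH => -[]. Qed.

Lemma convergent_notin x : x - c \in H -> x \notin C.
Proof.
case: CH => -[_ _ _ Cp /fsubsetP CS] _ xc; apply: contra cS => xC; apply: CS.
by apply: (period_mem Cp xC); rewrite sgBC.
Qed.

(** As [X + Y] lies in [c + H] and [c] is not in [S], [K] is strictly smaller than [H]. By
    minimality of [H], adjoining [X + Y] to [C] and replacing [H] by [K] cannot give a convergent;
    the inequality that fails, combined with Kneser's bound for the smaller sumset [X + Y], is the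
    gain. *)
Lemma local_bound (X Y : {fset G}) (K := stab (X :+: Y)) :
  X != fset0 -> Y != fset0 -> X `<=` A -> Y `<=` B -> X :+: H0 = X ->
  (forall x y, x \in X -> y \in Y -> x + y - c \in H) ->
  [/\ is_subgroup K, K `<=` H &
   (#|` X :+: K| + #|` Y :+: K| + #|` K| + #|` U :+: H| <= #|` H| + #|` U :+: K|)%N
   /\ (#|` X :+: K| + #|` Y :+: K| <= #|` X :+: Y| + #|` K|)%N].
Proof.
move=> X0 Y0 XA YB XH0 XYc.
have [[_ H0H C0 Cp CS] Cc] := CH.
have XY0 : X :+: Y != fset0 by apply: sumset_neq0.
have sK : is_subgroup K by apply: stab_sg.
have XYS : X :+: Y `<=` S by apply: sumsetS.
have inc z : z \in X :+: Y -> z - c \in H by move=> /sumsetP[x [y [? ? ->]]]; apply: XYc.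
have KH : K `<=` H.
  apply/fsubsetP=> g /(stabP _ XY0) gK; have /fset0Pn[z zXY] := XY0.
  have := sgB sH (inc _ (gK _ zXY)) (inc _ zXY).
  by rewrite opprB addrA subrK addrK.
have XYp : X :+: Y :+: K = X :+: Y by apply: stab_period.
have ltKH : (#|` K| < #|` H|)%N.
  apply: fproper_ltn_card; rewrite fproperE KH /=; apply/negP=> /fsubsetP HK.
  have /fset0Pn[z zXY] := XY0; move/negP: cS; apply; apply: (fsubsetP XYS).
  by apply: (period_mem XYp zXY); apply: HK; rewrite sgBC // inc.
have dj z : z \in C -> z \in X :+: Y -> False.
  by move=> zC /inc/convergent_notin; rewrite zC.
have cCXY := card_disjU dj.
have kXY : kneser_bound X Y.
  apply: IH_card => //.
  have : (#|` C `|` (X :+: Y)| <= #|` S|)%N.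
    by apply: fsubset_leq_card; rewrite fsubUset CS.
  rewrite cCXY; have := C0; rewrite -cardfs_gt0; card_lia.
have H0K : H0 `<=` K.
  by apply: sub_stab => //; rewrite -sumsetA [Y :+: _]sumsetC sumsetA XH0.
have nconv : ~ (#|` I| + #|` U :+: K| <= #|` C `|` (X :+: Y)| + #|` K|)%N.
  move=> le; have := @minH (C `|` (X :+: Y)) K; rewrite leqNgt ltKH => /(_ _)/negP[] //.
  split=> //; split => //; last by rewrite fsubUset CS.
    by rewrite -cardfs_gt0 cCXY addn_gt0 cardfs_gt0 C0.
  by rewrite sumsetUl XYp (period_sub sK sH KH Cp).
split=> //; split=> //; move: kXY nconv; rewrite /kneser_bound -/K cCXY => kXY nconv.
(* The five cardinals to be compared are multiples of [|K|], so a strict inequality between their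
   sums improves by a full [|K|]. *)
have d1 := dvdn_sumK X sK sK (fsubset_refl K).
have d2 := dvdn_sumK Y sK sK (fsubset_refl K).
have d3 := dvdn_sumK U sK sH KH.
have d4 := dvdn_period sK (sumKK_sub H sK sH KH).
have d5 := dvdn_sumK U sK sK (fsubset_refl K).
rewrite sumKK // in d4.
have K0 := sg_gt0 sK.
have : (#|` X :+: K| + #|` Y :+: K| + #|` U :+: H| < #|` H| + #|` U :+: K|)%N by card_lia.
move: d1 d2 d3 d4 d5 => /dvdnP[p1 ->] /dvdnP[p2 ->] /dvdnP[p3 ->] /dvdnP[p4 ->] /dvdnP[p5 ->].
rewrite -!mulnDl ltn_mul2r K0 /= -mulSnr -mulnDl leq_mul2r => lt; apply/orP; right; card_lia.
Qed.

End Local.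

Lemma kneser_step : kneser_bound A B.
Proof.
rewrite /kneser_bound -/S -/H0 AH0 BH0 leqNgt; apply/negP=> lt.
have IU : (#|` I| + #|` U|)%N = (#|` A| + #|` B|)%N by rewrite addnC cardfsUI.
have [C [H [CH minH]]] : exists C H, convergent C H /\
    forall C' H', convergent C' H' -> (#|` H| <= #|` H'|)%N.
  have ex : exists n, `[< exists C H, convergent C H /\ #|` H| = n >].
    by have [C [H CH]] := convergent_exists; exists #|` H|; apply/asboolP; exists C, H.
  case: (ex_minnP ex) => n /asboolP[C [H [CH <-]]] min; exists C, H; split => // C' H' CH'.
  by apply: min; apply/asboolP; exists C', H'.
have [[sH H0H C0 Cp CS] Cc] := CH.
(* If [H = H0], the inequality of the convergent already contradicts [lt]. Otherwise some [h] in [H]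
   is not a period of [S] and moves a sum [a + b] out of [S]. *)
have [HH0|HH0] := boolP (H `<=` H0).
  have EH : H = H0 by apply/eqP; rewrite eqEfsubset HH0.
  have := fsubset_leq_card CS; have := fsubset_leq_card (sub_sumK U sH); rewrite EH in Cc *.
  card_lia.
have [h hH hH0] := fsubsetPn _ _ HH0.
have [a [b [aA bB cS]]] : exists a b, [/\ a \in A, b \in B & h + (a + b) \notin S].
  apply: contrapT => nex; move/negP: hH0; apply; apply/(stabP _ S_neq0) => x xS.
  have /sumsetP[a [b [aA bB E]]] := xS; apply: contrapT => /negP nS.
  by apply: nex; exists a, b; rewrite -E.
set c := h + (a + b) in cS.
have inc x y : x + y - (a + b) \in H -> x + y - c \in H.
  move=> xy; apply: (sg_trans sH xy); rewrite sgBC // /c addrK //.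
pose A1 := part H A a; pose B1 := part H B b.
pose A2 := part H A b; pose B2 := part H B a.
have aA1 : a \in A1 by rewrite in_part aA subrr sg0.
have bB1 : b \in B1 by rewrite in_part bB subrr sg0.
have A10 : A1 != fset0 by apply/fset0Pn; exists a.
have B10 : B1 != fset0 by apply/fset0Pn; exists b.
have loc X Y := local_bound CH minH cS (X := X) (Y := Y).
have [] := loc _ _ A10 B10 (part_sub _ _ _) (part_sub _ _ _) (part_period a sH sH0 H0H AH0).
  move=> x y; rewrite !in_part => /andP[_ xa] /andP[_ yb]; apply: inc.
  by rewrite opprD addrACA sgD.
set H1 := stab (A1 :+: B1) => sH1 H1H [bd1 kn1].
have aU : a \in U by apply: (fsubsetP AU).
have bU : b \in U by apply: (fsubsetP BU).
have ga K sK KH := part_gap sH sK KH aU (K := K).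
have gb K sK KH := part_gap sH sK KH bU (K := K).
have ga1 := ga _ sH1 H1H; have gb1 := gb _ sH1 H1H.
have pa1 := card_partU H A B H1 a; have pb1 := card_partU H A B H1 b.
have H1gt0 := sg_gt0 sH1.
(* Inside [a + H] the set [U] consists of [A1] and [B2], inside [b + H] of [A2] and [B1]. By [bd1]
   the pair [A1], [B1] is too small to fill these parts, so [A2] and [B2] are nonempty and [a], [b]
   lie in different cosets of [H]. *)
have ltB : (#|` B1 :+: H1| < #|` B2 :+: H1|)%N by rewrite -/A1 -/B2 in pa1; rewrite -/U in pa1; card_lia.
have ltA : (#|` A1 :+: H1| < #|` A2 :+: H1|)%N by rewrite -/A2 -/B1 in pb1; rewrite -/U in pb1; card_lia.
have [A20 _] : A2 != fset0 /\ H1 != fset0.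
  by apply: neq0_sumset; rewrite -cardfs_gt0; apply: leq_ltn_trans ltA.
have [B20 _] : B2 != fset0 /\ H1 != fset0.
  by apply: neq0_sumset; rewrite -cardfs_gt0; apply: leq_ltn_trans ltB.
have abH : a - b \notin H.
  by apply/negP=> /(part_eq A sH) E; move: ltA; rewrite /A1 E ltnn.
have [] := loc _ _ A20 B20 (part_sub _ _ _) (part_sub _ _ _) (part_period b sH sH0 H0H AH0).
  move=> x y; rewrite !in_part => /andP[_ xa] /andP[_ yb]; apply: inc.
  by rewrite [a + b]addrC opprD addrACA sgD.
set H2 := stab (A2 :+: B2) => sH2 H2H [bd2 kn2].
have UH1 : (#|` U :+: H1| <= #|` U :+: H|)%N by apply: fsubset_leq_card; rewrite sumsetS.
have UH2 : (#|` U :+: H2| <= #|` U :+: H|)%N by apply: fsubset_leq_card; rewrite sumsetS.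
pose E := (A1 :+: B1) `|` (A2 :+: B2).
have E1 : (#|` A1 :+: B1| <= #|` E|)%N by apply: fsubset_leq_card; apply: fsubsetUl.
have E2 : (#|` A2 :+: B2| <= #|` E|)%N by apply: fsubset_leq_card; apply: fsubsetUr.
have CE : (#|` C| + #|` E| <= #|` S|)%N.
  rewrite -card_disjU; last first.
    move=> z zC zE; suff /(convergent_notin CH cS) : z - c \in H by rewrite zC.
    move: zE; rewrite inE => /orP[] /sumsetP[x [y [+ + ->]]];
      rewrite !in_part => /andP[_ xa] /andP[_ yb]; apply: inc.
      by rewrite opprD addrACA sgD.
    by rewrite [a + b]addrC opprD addrACA sgD.
  by apply: fsubset_leq_card; rewrite !fsubUset CS !sumsetS ?part_sub.
have gap2 := part_gap2 sH aU bU abH.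
have p1 : (#|` part H U a| <= #|` A1| + #|` B2|)%N by rewrite partU -cardfsUI leq_addr.
have p2 : (#|` part H U b| <= #|` A2| + #|` B1|)%N by rewrite partU -cardfsUI leq_addr.
have s1 := fsubset_leq_card (sub_sumK A1 sH1).
have s2 := fsubset_leq_card (sub_sumK B1 sH1).
have s3 := fsubset_leq_card (sub_sumK A2 sH2).
have s4 := fsubset_leq_card (sub_sumK B2 sH2).
have H0gt0 := sg_gt0 sH0.
(* One pair is bounded by [|E| + |H1|] or [|E| + |H2|], the other by [|H| - |H2|] or [|H| - |H1|].
   Adding both choices cancels [|H1|] and [|H2|] and gives [|A1| + |B1| + |A2| + |B2| <= |E| + |H|],
   whereas [lt], [Cc], [CE] and [gap2] force the opposite strict inequality. *)
card_lia.
Qed.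

End KneserStep.

(** Induction on [|A + B|], then on [2|A + B| - |A| - |B|], then on [|A|]. The second quantity drops
    when a summand that is not periodic is filled up to cosets of [H0]; the third serves the pair
    [I], [U] in the inductive step. *)
Theorem kneser (G : zmodType) (A B : {fset G}) :
  A != fset0 -> B != fset0 -> kneser_bound A B.
Proof.
have [n] := ubnP #|` A :+: B|; elim: n A B => // n IHn A B ltn.
have [t] := ubnP (2 * #|` A :+: B| - (#|` A| + #|` B|)); elim: t A B ltn => // t IHt A B ltn ltt.
have [k] := ubnP #|` A|; elim: k A B ltn ltt => // k IHk A B ltn ltt ltk A0 B0.
have AleS : (#|` A| <= #|` A :+: B|)%N by rewrite sumsetC card_sumset_ge.
have BleS := card_sumset_ge B A0.
have S0 := sumset_neq0 A0 B0.
set S := A :+: B in S0 ltn ltt AleS BleS; have sH0 := stab_sg S0; set H0 := stab S in sH0.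
have sA := sub_sumK A sH0; have sB := sub_sumK B sH0.
have Sp : S :+: H0 = S by apply: stab_period.
have ES : (A :+: H0) :+: (B :+: H0) = S.
  by rewrite sumsetA -[A :+: H0 :+: B]sumsetA [H0 :+: B]sumsetC sumsetA -/S Sp Sp.
have [per|nper] := boolP ((A :+: H0 == A) && (B :+: H0 == B)); last first.
  have := fsubset_leqif_cards sA; have := fsubset_leqif_cards sB.
  move=> [leB eB] [leA eA].
  have HA0 : A :+: H0 != fset0 by rewrite -cardfs_gt0; apply: leq_trans leA; rewrite cardfs_gt0.
  have HB0 : B :+: H0 != fset0 by rewrite -cardfs_gt0; apply: leq_trans leB; rewrite cardfs_gt0.
  have AleS' : (#|` A :+: H0| <= #|` S|)%N by have := card_sumset_ge (A :+: H0) HB0; rewrite [_ :+: (A :+: _)]sumsetC ES.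
  have BleS' : (#|` B :+: H0| <= #|` S|)%N by have := card_sumset_ge (B :+: H0) HA0; rewrite ES.
  have := IHt (A :+: H0) (B :+: H0); rewrite ES => IH.
  suff : kneser_bound (A :+: H0) (B :+: H0) by rewrite /kneser_bound ES -/H0 !sumsetKK.
  apply: IH => //; move: nper; rewrite eq_sym -eA (eq_sym _ B) -eB negb_and; card_lia.
have [/eqP AH0 /eqP BH0] := andP per.
have [aux|naux] := boolP (#|` A| + #|` B| <= #|` S| + #|` H0|)%N.
  by rewrite /kneser_bound -/S -/H0 AH0 BH0.
have /fset0Pn[a aA] := A0.
have [a' a'A aa'] : exists2 a', a' \in A & a' - a \notin H0.
  apply: contrapT => nex; move/negP: naux; apply.
  have : (#|` A| <= #|` H0|)%N.
    rewrite -(card_coset a H0); apply: fsubset_leq_card; apply/fsubsetP=> x xA.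
    by rewrite mem_coset; apply: contrapT => /negP nx; apply: nex; exists x.
  card_lia.
have [b bB b'B] : exists2 b, b \in B & b + (a' - a) \notin B.
  apply: contrapT => nex; move/negP: aa'; apply; apply/(stabP _ S0) => _ /sumsetP[x [y [xA yB ->]]].
  rewrite addrCA mem_sumset // addrC; apply: contrapT => /negP nB; apply: nex; exists y => //.
(* This translate of [B] contains [a] but not [a'], so it meets [A] in a nonempty proper subset of
   [A]. *)
pose B' := add_coset (a - b) B.
have EB' : A :+: B' = add_coset (a - b) S by rewrite sumsetC coset_sumset sumsetC.
have cS' : #|` A :+: B'| = #|` S| by rewrite EB' card_coset.
have st' : stab (A :+: B') = H0 by rewrite EB' stab_coset.
have cB' : #|` B'| = #|` B| by rewrite card_coset.
have : kneser_bound A B'; last first.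
  by rewrite /kneser_bound cS' st' coset_sumset card_coset.
apply: kneser_step.
- by apply/fset0Pn; exists a; rewrite inE aA mem_coset opprB addrCA subrr addr0.
- apply: fproper_ltn_card; apply: fproperIl; apply/negP=> /fsubsetP/(_ _ a'A).
  by rewrite mem_coset opprB addrCA (negPf b'B).
- by rewrite st'.
- by rewrite st' coset_sumset BH0.
- by move=> X Y X0 Y0; rewrite cS' => lt; apply: IHn => //; move: lt ltn; rewrite -/S; card_lia.
move=> X Y X0 Y0; rewrite cS' cB' => e1 e2 lt; apply: IHk; rewrite ?e1 ?e2 //; card_lia.
Qed.

(** * Sumsets in an extension of the integers *)

Lemma fset_argmax (T : choiceType) (f : T -> int) (X : {fset T}) :
  X != fset0 -> exists2 x, x \in X & forall y, y \in X -> f y <= f x.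
Proof.
have [n] := ubnP #|` X|; elim: n X => // n IHn X ltn /fset0Pn[x xX].
have [X0|X0] := eqVneq (X `\ x) fset0.
  exists x => // y yX; have [->//|yx] := eqVneq y x.
  by have := in_fset0 y; rewrite -X0 !inE yx yX.
have [|y + ymax] := IHn _ _ X0.
  by move: ltn; rewrite (cardfsD1 x X) xX; lia.
rewrite !inE => /andP[yx yX].
have [xy|yx'] := leP (f x) (f y).
  by exists y => // z zX; have [->//|zx] := eqVneq z x; apply: ymax; rewrite !inE zx.
exists x => // z zX; have [->//|zx] := eqVneq z x.
by apply: le_trans (ltW yx'); apply: ymax; rewrite !inE zx.
Qed.

(** The stabilizer of a finite set of integers is trivial, since neither a period nor its negative
    can raise the maximum; Kneser's theorem does the rest. *)
Lemma card_sumset_int (X Y : {fset int}) : X != fset0 -> Y != fset0 ->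
  (#|` X| + #|` Y| <= #|` X :+: Y| + 1)%N.
Proof.
move=> X0 Y0; have XY0 := sumset_neq0 X0 Y0; have sH := stab_sg XY0.
have := kneser X0 Y0; rewrite /kneser_bound; set H := stab _ in sH *.
have H1 : H `<=` [fset 0].
  apply/fsubsetP=> g gH; rewrite inE; have [x xXY xmax] := fset_argmax id XY0.
  have /(stabP _ XY0)/(_ _ xXY)/xmax := gH.
  have /(stabP _ XY0)/(_ _ xXY)/xmax := sgN sH gH.
  by move=> /= ? ?; apply/eqP; lia.
have := fsubset_leq_card H1; rewrite cardfs1.
have := fsubset_leq_card (sub_sumK X sH); have := fsubset_leq_card (sub_sumK Y sH).
card_lia.
Qed.

Lemma card_fset_filter (T : choiceType) (X : {fset T}) (P : pred T) :
  #|` [fset x in X | P x]| = (\sum_(x <- X) P x)%N.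
Proof. by rewrite card_fset_sum1 -big_fset_condE big_mkcond; apply: eq_bigr => x _; case: (P x). Qed.

Lemma sum_ltn_ord n k : (\sum_(t < n) (t < k) = minn n k)%N.
Proof. by elim: n => [|n IHn]; rewrite ?big_ord0 ?min0n // big_ord_recr IHn /=; lia. Qed.

Section Levels.
Variables (G : zmodType) (lam : {additive G -> int}) (K : {fset G}).
Hypothesis sK : is_subgroup K.
Implicit Types (X Y C D : {fset G}).

Definition levels X : {fset int} := [fset lam x | x in X].
Definition fib X (u : int) : {fset G} := [fset x in X | lam x == u].
(** The sizes of the layers form the partition conjugate to the sizes of the fibers. *)
Definition lay X (t : nat) : {fset int} := [fset u in levels X | (t <= #|` fib X u|)%N].

Definition level_compat X := forall x y, x \in X -> y \in X -> lam x = lam y -> x - y \in K.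

Lemma levelsP X u : reflect (exists2 x, x \in X & u = lam x) (u \in levels X).
Proof. exact: imfsetP. Qed.

Lemma mem_levels X x : x \in X -> lam x \in levels X.
Proof. by move=> xX; apply/levelsP; exists x. Qed.

Lemma in_fib X u x : (x \in fib X u) = (x \in X) && (lam x == u).
Proof. by rewrite !inE. Qed.

Lemma in_lay X t u : (u \in lay X t) = (u \in levels X) && (t <= #|` fib X u|)%N.
Proof. by rewrite !inE. Qed.

Lemma lay_pos X t u : (0 < t)%N -> (t <= #|` fib X u|)%N -> u \in lay X t.
Proof.
move=> t0 le; rewrite in_lay le andbT.
have /fset0Pn[x] : fib X u != fset0 by rewrite -cardfs_gt0; apply: leq_trans le.
by rewrite in_fib => /andP[xX /eqP<-]; apply: mem_levels.
Qed.

Lemma card_fib_le X u : level_compat X -> (#|` fib X u| <= #|` K|)%N.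
Proof.
move=> cX; have [->|/fset0Pn[x]] := eqVneq (fib X u) fset0; first by rewrite cardfs0.
rewrite in_fib => /andP[xX /eqP xu]; rewrite -(card_coset x K).
apply: fsubset_leq_card; apply/fsubsetP=> y; rewrite in_fib mem_coset => /andP[yX /eqP yu].
by apply: cX; rewrite // yu xu.
Qed.

Lemma sum_lay X : level_compat X ->
  #|` X| = (\sum_(t < #|` K|) #|` lay X t.+1|)%N.
Proof.
move=> cX; rewrite card_fset_sum1 (partition_big_imfset _ lam) -/(levels X).
under [in RHS]eq_bigr do rewrite card_fset_filter.
rewrite exchange_big /=; apply: eq_bigr => u _.
rewrite big_fset_condE -card_fset_sum1 -/(fib X u).
have := card_fib_le u cX; set k := #|` fib X u| => lek.
by rewrite (eq_bigr (fun t : 'I__ => (t < k)%N : nat)) // sum_ltn_ord; apply/esym/minn_idPr.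
Qed.

Lemma level_compat_sumset C D : level_compat (C :+: D) -> D != fset0 -> level_compat C.
Proof.
move=> cCD /fset0Pn[d dD] x y xC yC xy.
have := cCD (x + d) (y + d); rewrite !(raddfD lam) xy opprD addrACA subrr addr0.
by apply; rewrite ?mem_sumset.
Qed.

Hypothesis lamK : forall k, k \in K -> lam k = 0.

Lemma levels_sumK X : levels (X :+: K) = levels X.
Proof.
apply/fsetP=> u; apply/levelsP/levelsP => [[_ /sumsetP[x [k [xX kK ->]]] ->]|[x xX ->]].
  by exists x; rewrite // (raddfD lam) (lamK kK) addr0.
by exists x; rewrite // (fsubsetP (sub_sumK X sK)).
Qed.

Lemma card_sumK_levels X : level_compat X -> #|` X :+: K| = (#|` K| * #|` levels X|)%N.
Proof.
move=> cX; have cXK : level_compat (X :+: K).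
  move=> _ _ /sumsetP[x [k [xX kK ->]]] /sumsetP[y [l [yX lK ->]]].
  rewrite !(raddfD lam) (lamK kK) (lamK lK) !addr0 => xy.
  by rewrite opprD addrACA; apply: sgD => //; [apply: cX|apply: sgB].
rewrite (sum_lay cXK) (eq_bigr (fun=> #|` levels X|)) ?sum_nat_const ?card_ord //.
move=> t _; congr #|` _|; apply/fsetP=> u; rewrite in_lay levels_sumK.
case: levelsP => //= -[x xX ->]; apply: leq_trans (ltn_ord t) _.
rewrite -(card_coset x K); apply: fsubset_leq_card; apply/fsubsetP=> y.
rewrite mem_coset in_fib => yx; apply/andP; split; first by apply/mem_sumK; exists x.
by rewrite -subr_eq0 -(raddfB lam) lamK.
Qed.

Lemma card_fib_sumset C D x u : x \in C -> (#|` fib D u| <= #|` fib (C :+: D) (lam x + u)|)%N.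
Proof.
move=> xC; rewrite -(card_coset x); apply: fsubset_leq_card; apply/fsubsetP=> y.
rewrite mem_coset !in_fib => /andP[yD /eqP <-].
by rewrite -(raddfD lam) addrC subrK eqxx andbT -(subrK x y) addrC mem_sumset.
Qed.

(** Pigeonhole: [fib C u] and [z - fib D v] lie in one coset of [K] and together have more than
    [|K|] elements, so they meet and [z] is a sum. *)
Lemma fib_full C D u v : C != fset0 -> D != fset0 -> level_compat (C :+: D) ->
  (#|` K| < #|` fib C u| + #|` fib D v|)%N -> (#|` K| <= #|` fib (C :+: D) (u + v)|)%N.
Proof.
move=> C0 D0 cCD lt; have cC := level_compat_sumset cCD D0.
have cD : level_compat D by apply: level_compat_sumset C0; rewrite sumsetC; apply: cCD.
have leC := card_fib_le u cC; have leD := card_fib_le v cD.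
have /fset0Pn[x] : fib C u != fset0 by rewrite -cardfs_gt0; card_lia.
have /fset0Pn[y] : fib D v != fset0 by rewrite -cardfs_gt0; card_lia.
rewrite !in_fib => /andP[yD /eqP yv] /andP[xC /eqP xu].
rewrite -(card_coset (x + y) K); apply: fsubset_leq_card; apply/fsubsetP=> z.
rewrite mem_coset => zxy; pose Z := [fset z - w | w in fib D v].
have cZ : #|` Z| = #|` fib D v|.
  by rewrite card_imfset // => a b /addrI/oppr_inj.
suff : fib C u `&` Z != fset0.
  case/fset0Pn=> a; rewrite inE in_fib => /andP[/andP[aC /eqP au] /imfsetP[b /=]].
  rewrite !in_fib => /andP[bD /eqP bv] Ea; rewrite -[z](subrK b) -Ea mem_sumset //=.
  by rewrite (raddfD lam) au bv.
rewrite -cardfs_gt0; have := cardfsUI (fib C u) Z; rewrite cZ.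
have : (#|` fib C u `|` Z| <= #|` K|)%N.
  rewrite -(card_coset x K); apply: fsubset_leq_card; rewrite fsubUset; apply/andP; split.
    by apply/fsubsetP=> a; rewrite in_fib mem_coset => /andP[aC /eqP au]; apply: cC; rewrite ?au.
  apply/fsubsetP=> _ /imfsetP[b /= + ->]; rewrite in_fib mem_coset => /andP[bD /eqP bv].
  have -> : z - b - x = z - (x + y) + (y - b) by rewrite opprD !addrA subrK addrAC.
  by apply: sgD => //; apply: cD; rewrite // yv bv.
by rewrite -yv -xu in lt *; card_lia.
Qed.

(* Layer t of C + D contains the sum of layer t of C and all levels of D. When
   layer t of C is empty, the full fibers of C + D are used instead: averaging
   over complementary layers shows that there are enough of them. *)
Lemma card_sumset_levels C D : C != fset0 -> D != fset0 -> level_compat (C :+: D) ->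
  (#|` C :+: K| < #|` C| + #|` D|)%N -> (#|` D :+: K| < #|` C| + #|` D|)%N ->
  (#|` C| + #|` D :+: K| <= #|` C :+: D| + #|` K|)%N.
Proof.
move=> C0 D0 cCD; have cC := level_compat_sumset cCD D0.
have cD : level_compat D by apply: level_compat_sumset C0; rewrite sumsetC; apply: cCD.
rewrite !card_sumK_levels // => ltC ltD.
have lD0 : levels D != fset0.
  by have /fset0Pn[y yD] := D0; apply/fset0Pn; exists (lam y); apply: mem_levels.
have lay_le X t : (#|` lay X t| <= #|` levels X|)%N.
  by apply: fsubset_leq_card; apply/fsubsetP=> u; rewrite in_lay => /andP[].
(* Fibers with at least [t + 1] and at least [|K| - t] elements together exceed [|K|], so their sum
   is full. If no [t] qualified, summing over [t] would give [|C| + |D|] at most [|K|] times the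
   larger number of levels, against [ltC] and [ltD]. *)
have [t ltt] : exists t : 'I_#|` K|,
    (maxn #|` levels C| #|` levels D| < #|` lay C t.+1| + #|` lay D (#|` K| - t)|)%N.
  apply/existsP; apply: contraT; rewrite negb_exists => /forallP le.
  have : (\sum_(t < #|` K|) (#|` lay C t.+1| + #|` lay D (#|` K| - t)|) <=
          #|` K| * maxn #|` levels C| #|` levels D|)%N.
    rewrite -[X in (_ <= X * _)%N]card_ord -sum_nat_const; apply: leq_sum => t _.
    by rewrite leqNgt; apply: le.
  rewrite big_split /= -sum_lay // [X in (_ + X)%N](reindex_inj rev_ord_inj) /=.
  under [X in (_ + X)%N]eq_bigr => t _ do rewrite subKn //.
  rewrite -sum_lay // maxnMr; move: ltC ltD; card_lia.
have lC : (0 < #|` lay C t.+1|)%N by have := lay_le D (#|` K| - t)%N; card_lia.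
have lD : (0 < #|` lay D (#|` K| - t)|)%N by have := lay_le C t.+1; card_lia.
have step s : (s < #|` K|)%N ->
    (#|` lay C s.+1| + #|` levels D| <= #|` lay (C :+: D) s.+1| + 1)%N.
  move=> ltsK; have [E|ls0] := eqVneq (lay C s.+1) fset0; last first.
    apply: leq_trans (card_sumset_int ls0 lD0) _; rewrite leq_add2r.
    apply: fsubset_leq_card; apply/fsubsetP=> _ /sumsetP[u [v [uC /levelsP[y yD ->] ->]]].
    apply: lay_pos => //; move: uC; rewrite in_lay => /andP[_ /leq_trans]; apply.
    by rewrite addrC [C :+: D]sumsetC; apply: card_fib_sumset.
  rewrite !cardfs_gt0 in lC lD; have := card_sumset_int lC lD.
  have : lay C t.+1 :+: lay D (#|` K| - t) `<=` lay (C :+: D) s.+1.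
    apply/fsubsetP=> _ /sumsetP[u [v [+ + ->]]]; rewrite (in_lay C) (in_lay D) => /andP[_ uC] /andP[_ vD].
    apply: lay_pos => //; apply: leq_trans ltsK _; apply: fib_full => //.
    by have := ltn_ord t; card_lia.
  by rewrite E cardfs0 => /fsubset_leq_card; card_lia.
have : (\sum_(s < #|` K|) (#|` lay C s.+1| + #|` levels D|) <=
        \sum_(s < #|` K|) (#|` lay (C :+: D) s.+1| + 1))%N.
  by apply: leq_sum => s _; apply: step.
by rewrite !big_split /= -!sum_lay // !sum_nat_const card_ord muln1.
Qed.

End Levels.

(** * Torsion and homomorphisms to the integers *)

Section CyclicQuotient.
Variables (G : zmodType) (d : G).

Definition multiple : {pred G} := fun x => `[< exists j : int, x = d *~ j >].

Lemma multiple_zmod_closed : zmod_closed multiple.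
Proof.
split=> [|x y /asboolP[i ->] /asboolP[j ->]]; apply/asboolP.
  by exists 0; rewrite mulr0z.
by exists (i - j); rewrite mulrzBr.
Qed.

HB.instance Definition _ := GRing.isZmodClosed.Build G multiple multiple_zmod_closed.

Lemma cyclic_quotient : exists (Q : zmodType) (pi : {additive G -> Q}),
  forall x y, pi x = pi y <-> exists j : int, x - y = d *~ j.
Proof.
pose I : zmodClosed G := multiple.
exists (Quotient.quot I), (\pi_(Quotient.quot I)%qT) => x y.
split=> [/eqP|[j E]]; last apply/eqP.
  by rewrite -Quotient.idealrBE => /asboolP.
by rewrite -Quotient.idealrBE; apply/asboolP; exists j.
Qed.

End CyclicQuotient.

Section Torsion.
Variable G : zmodType.

(** Generators are adjoined one at a time: the multiples of a torsion element form a finite group,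
    and a sum of two finite subgroups is a finite subgroup. *)
Lemma torsion_subgroup (s : seq G) : (forall x, x \in s -> exists2 e, (0 < e)%N & x *+ e = 0) ->
  exists2 K : {fset G}, is_subgroup K & forall x, x \in s -> x \in K.
Proof.
elim: s => [_|x s IHs tors].
  exists [fset 0] => //; split=> [|a b]; rewrite !inE // => /eqP-> /eqP->.
  by rewrite subrr.
have [|K sK Ks] := IHs; first by move=> y ys; apply: tors; rewrite inE ys orbT.
have [e e0 xe] := tors x (mem_head _ _).
pose X := [fset x *+ j | j in iota 0 e].
have XP z : reflect (exists j, z = x *+ j) (z \in X).
  apply: (iffP (imfsetP _ _ _ _)) => [[j _ ->]|[j ->]]; first by exists j.
  exists (j %% e)%N; first by rewrite /= mem_iota add0n ltn_mod.
  by rewrite {1}(divn_eq j e) mulrnDr mulnC mulrnA xe mul0rn add0r.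
have sX : is_subgroup X.
  split=> [|_ _ /XP[i ->] /XP[j ->]]; first by apply/XP; exists 0%N; rewrite mulr0n.
  apply/XP; exists (i + j * e.-1)%N; rewrite mulrnDr; congr (_ + _).
  by apply/eqP; rewrite eq_sym -subr_eq0 opprK -mulrnDr -mulnSr prednK // mulnC mulrnA xe mul0rn.
exists (X :+: K).
  split=> [|_ _ /sumsetP[a [b [aX bK ->]]] /sumsetP[a' [b' [a'X b'K ->]]]].
    by rewrite -[0]addr0 mem_sumset ?sg0.
  by rewrite opprD addrACA mem_sumset ?sgB.
move=> y; rewrite inE => /orP[/eqP->|/Ks yK].
  by rewrite -[x]addr0 mem_sumset ?sg0 //; apply/XP; exists 1%N; rewrite mulr1n.
by rewrite -[y]add0r mem_sumset ?sg0.
Qed.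

End Torsion.

(** * Homomorphisms to the integers that separate up to torsion *)

Section Separation.
Variable G : zmodType.

Fixpoint zspan (s : seq G) : G -> Prop :=
  if s is b :: s' then fun x => exists z : int, zspan s' (x - b *~ z) else fun x => x = 0.

Lemma zspan0 s : zspan s 0.
Proof. by elim: s => //= b s IHs; exists 0; rewrite mulr0z subr0. Qed.

Lemma zspanB s x y : zspan s x -> zspan s y -> zspan s (x - y).
Proof.
elim: s x y => [x y /= -> ->|b s IHs x y /= [z xz] [t yt]]; first by rewrite subr0.
exists (z - t); rewrite mulrzBr.
have -> : x - y - (b *~ z - b *~ t) = (x - b *~ z) - (y - b *~ t); last exact: IHs.
by rewrite !opprD !opprK addrACA.
Qed.

Lemma zspanN s x : zspan s x -> zspan s (- x).
Proof. by move=> sx; rewrite -sub0r; apply: zspanB => //; apply: zspan0. Qed.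

Lemma zspanD s x y : zspan s x -> zspan s y -> zspan s (x + y).
Proof. by move=> sx sy; rewrite -[y]opprK; apply: zspanB => //; apply: zspanN. Qed.

Lemma zspanMn s x n : zspan s x -> zspan s (x *+ n).
Proof.
move=> sx; elim: n => [|n IHn]; first by rewrite mulr0n; apply: zspan0.
by rewrite mulrS; apply: zspanD.
Qed.

Lemma zspanMz s x z : zspan s x -> zspan s (x *~ z).
Proof. by case: z => n sx; [apply: zspanMn|apply: zspanN; apply: zspanMn]. Qed.

Lemma zspan_mem s x : x \in s -> zspan s x.
Proof.
elim: s => //= b s IHs; rewrite inE => /orP[/eqP->|/IHs sx].
  by exists 1; rewrite mulr1z subrr; apply: zspan0.
by exists 0; rewrite mulr0z subr0.
Qed.

Definition torsion (x : G) := exists2 e, (0 < e)%N & x *+ e = 0.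

(** Induction on the generators. If a positive multiple [b *+ e] lies in the span of the others,
    precompose with multiplication by [e], whose kernel is torsion. Otherwise the coordinate along
    [b] is well defined and is added with a large weight. Additivity is claimed only on the span. *)
Lemma separating_hom (s w : seq G) : (forall x, x \in w -> zspan s x) ->
  exists lam : G -> int, (forall x y, zspan s x -> zspan s y -> lam (x + y) = lam x + lam y) /\
    (forall x, x \in w -> lam x = 0 -> torsion x).
Proof.
elim: s w => [|b s IHs] w sw.
  exists (fun=> 0); split=> [x y _ _|x /sw /= -> _]; first by rewrite addr0.
  by exists 1%N.
have [[e e0 sbe]|indep] := pselect (exists2 e, (0 < e)%N & zspan s (b *+ e)).
  have se x : zspan (b :: s) x -> zspan s (x *+ e).
    move=> [z /(zspanMn e)]; rewrite mulrnBl (pmulrn (b *~ z)) mulrzAC -pmulrn => sx.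
    by rewrite -[x *+ e](subrK (b *+ e *~ z)); apply: zspanD => //; apply: zspanMz.
  have [|lam [lamD lam0]] := IHs [seq x *+ e | x <- w].
    by move=> _ /mapP[x xw ->]; apply/se/sw.
  exists (fun x => lam (x *+ e)); split=> [x y /se sx /se sy|x xw l0].
    by rewrite mulrnDl lamD.
  have [|f f0 xef] := lam0 _ _ l0; first exact: map_f.
  by exists (e * f)%N; rewrite ?muln_gt0 ?e0 // mulrnA.
have [z zP] : {z : G -> int & forall x, zspan (b :: s) x -> zspan s (x - b *~ z x)}.
  apply: (@choice _ _ (fun x z => zspan (b :: s) x -> zspan s (x - b *~ z))) => x.
  by have [[z xz]|nx] := pselect (zspan (b :: s) x); [exists z|exists 0].
have inj k : zspan s (b *~ k) -> k = 0.
  case: k => [[|n]|n] // sk; exfalso; apply: indep; exists n.+1 => //.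
  by rewrite -[_ *+ _]opprK; apply: zspanN.
have zD x y : zspan (b :: s) x -> zspan (b :: s) y -> z (x + y) = z x + z y.
  move=> sx sy; apply/eqP; rewrite -subr_eq0; apply/eqP/inj.
  have := zspanB (zspanD (zP _ sx) (zP _ sy)) (zP _ (zspanD sx sy)).
  rewrite mulrzBr mulrzDr; congr zspan.
  by rewrite [x - _ + _]addrACA -opprD opprB [LHS]addrC addrA subrK.
have [|lam [lamD lam0]] := IHs [seq x - b *~ z x | x <- w].
  by move=> _ /mapP[x xw ->]; apply/zP/sw.
(* The weight exceeds each [|lam (x - b *~ z x)|] with [x] in [w], so the new value vanishes only if
   [z x = 0]. *)
pose M : int := \sum_(x <- w) `|lam (x - b *~ z x)| + 1.
exists (fun x => lam (x - b *~ z x) + z x * M); split=> [x y sx sy|x xw l0].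
  rewrite zD // mulrDl addrACA -lamD; try exact: zP.
  by rewrite mulrzDr opprD addrACA.
have leM : `|lam (x - b *~ z x)| < M.
  rewrite /M (perm_big _ (perm_to_rem xw)) big_cons /= ltzD1 lerDl.
  exact: sumr_ge0.
have zx0 : z x = 0.
  by nia.
have := lam0 (x - b *~ z x); rewrite (map_f (fun x => x - b *~ z x) xw).
by rewrite zx0 mulr0z subr0 in l0 *; apply=> //; move: l0; rewrite mul0r addr0.
Qed.

End Separation.

(** * Reduction modulo the spread of the levels *)

Lemma sumset0 (G : zmodType) (X : {fset G}) : X :+: [fset 0] = X.
Proof.
apply/fsetP=> x; apply/sumsetP/idP => [[y [z [yX + ->]]]|xX].
  by rewrite inE => /eqP->; rewrite addr0.
by exists x, 0; rewrite inE addr0.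
Qed.

Lemma card_imfset2_inj (T1 T2 T : choiceType) (f : T1 -> T2 -> T) (X : {fset T1}) (Y : {fset T2}) :
  (forall x x' y y', x \in X -> x' \in X -> y \in Y -> y' \in Y ->
     f x y = f x' y' -> x = x' /\ y = y') ->
  #|` [fset f x y | x in X, y in Y]| = (#|` X| * #|` Y|)%N.
Proof.
move=> inj; rewrite (perm_size (enum_imfset2 _ _)) ?size_allpairs //=.
move=> [x y] [x' y']; rewrite !inE /= => /andP[xX yY] /andP[x'X y'Y] E.
by have [-> ->] := inj _ _ _ _ xX x'X yY y'Y E.
Qed.

Lemma imfset_sumset (G Q : zmodType) (pi : {additive G -> Q}) (X Y : {fset G}) :
  pi @` (X :+: Y) = (pi @` X) :+: (pi @` Y).
Proof.
apply/fsetP=> z; apply/imfsetP/sumsetP => [[_ /sumsetP[x [y [xX yY ->]]] ->]|].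
  by exists (pi x), (pi y); rewrite !in_imfset // (raddfD pi).
move=> [_ [_ [/imfsetP[x /= xX ->] /imfsetP[y /= yY ->] ->]]].
by exists (x + y); rewrite ?(raddfD pi) ?mem_sumset.
Qed.

Lemma card_image_le (T T' : choiceType) (f : T -> T') (X : {fset T}) :
  (#|` f @` X| <= #|` X|)%N.
Proof. exact: leq_imfset_card. Qed.

Lemma in_filter (T : choiceType) (X : {fset T}) (P : pred T) x :
  (x \in [fset y in X | P y]) = (x \in X) && P x.
Proof. by rewrite !inE. Qed.

(** In these four lemmas [m] counts the levels of [A], [s = |2A|], [a = |A|], [b = |pi A|], [r]
    counts the [x] in [A] with [x + d] in [A], [h = |H|], [N = |pi A + H|], [k = |K|],
    [E = |pi A + pi K|], and [q] is the size of an overlap. The first hypothesis says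
    [s < 3 (1 - 1/m) a]. *)
Lemma ends_arith m s a r : (m * s + 3 * a < 3 * m * a)%N -> (2 * m * r < 3 * a)%N ->
  (s + 2 * r < 3 * a)%N.
Proof.
move=> h1 h2; rewrite ltnNge; apply/negP=> /(leq_mul (leqnn m)).
by rewrite mulnDr; lia.
Qed.

Lemma hole_arith m s a b r h N : (m * s + 3 * a < 3 * m * a)%N -> (2 * m * r < 3 * a)%N ->
  (a <= b + r)%N -> (b <= N)%N -> (2 * N + a <= s + h)%N -> (2 * (N - b) < h)%N.
Proof.
move=> small1 small2 abr bN sN; rewrite ltnNge; apply/negP => hN.
have hbN : (h + 2 * b <= 2 * N)%N by lia.
have e1 := leq_mul (leqnn m) sN; have e2 := leq_mul (leqnn m) abr.
have e3 := leq_mul (leqnn m) hbN; rewrite !mulnDr in e1 e2 e3; lia.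
Qed.

Lemma split_arith m s a b r q h N k : (m * s + 3 * a < 3 * m * a)%N -> (2 * m * r < 3 * a)%N ->
  (2 < m)%N -> (a <= b + r)%N -> (r <= k)%N -> (k <= h)%N -> (2 * q <= k)%N ->
  (2 * N + a <= s + h)%N -> (m * k + h <= N + k)%N -> (a + 2 * b <= s + q)%N -> False.
Proof.
move=> small1 small2 m3 abr rk kh qk sN mN sq.
have e1 := leq_mul (leqnn m) sN; have e2 := leq_mul (leqnn m) sq.
have e3 := leq_mul (leqnn m) qk; have e4 := leq_mul (leqnn m) abr.
have hN : (2 * (N - b) < h)%N by nia.
have e5 := leq_mul (leqnn m) rk.
nia.
Qed.

Lemma class_arith m s a b r E k : (m * s + 3 * a < 3 * m * a)%N ->
  (2 < m)%N -> (a <= b + r)%N -> (r <= k)%N -> (b <= E)%N -> (m * k <= E + k)%N ->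
  (a + b + E <= s + k)%N -> False.
Proof.
move=> small m3 abr rk bE mE se.
have e1 := leq_mul (leqnn m) se; have e2 := leq_mul (leqnn m) abr.
have e3 := leq_mul (leqnn m) rk.
have e4 : ((m - 3) * b <= (m - 3) * E)%N by apply: leq_mul.
nia.
Qed.

Lemma card_iota_image (T : choiceType) (f : nat -> T) n : (#|` [fset f j | j in iota 0 n]| <= n)%N.
Proof.
apply: leq_trans (leq_imfset_card _ _ _) _; rewrite -[leqRHS](size_iota 0).
by apply: uniq_leq_size; [exact: enum_finmem_uniq|move=> j; rewrite enum_finmemE].
Qed.

(** * Lines in direction [d] *)

Section Lines.
Variables (G Q : zmodType) (lam : {additive G -> int}) (pi : {additive G -> Q}) (d : G).
Hypothesis lam_d : 0 < lam d.
Hypothesis piP : forall x y, pi x = pi y <-> exists j : int, x - y = d *~ j.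

(* Restated so that every occurrence of [lam x] elaborates in the same way,
   which [lia] needs. *)
Lemma lamD x y : lam (x + y) = lam x + lam y. Proof. exact: raddfD. Qed.
Lemma lamB x y : lam (x - y) = lam x - lam y. Proof. exact: raddfB. Qed.

Lemma lam_mulz j : lam (d *~ j) = lam d * j.
Proof. by rewrite (raddfMz lam) mulrzz. Qed.

Lemma pi_d : pi d = 0.
Proof. by rewrite -(raddf0 pi); apply/piP; exists 1; rewrite subr0 mulr1z. Qed.

Lemma pi_addd x : pi (x + d) = pi x.
Proof. by rewrite (raddfD pi) pi_d addr0. Qed.

(** The kernel of [pi] consists of the multiples of [d], on which [lam] is injective. *)
Lemma pi_level_inj x y : pi x = pi y -> lam x = lam y -> x = y.
Proof.
move=> /piP[j E] lxy; have := congr1 lam E; rewrite lamB lxy subrr lam_mulz.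
move/esym/eqP; rewrite mulf_eq0 gt_eqF //= => /eqP j0.
by move: E; rewrite j0 mulr0z => /eqP; rewrite subr_eq0 => /eqP.
Qed.

Definition shifted (M : {fset G}) : {fset G} := [fset x in M | x + d \in M].

Lemma in_shifted M x : (x \in shifted M) = (x \in M) && (x + d \in M).
Proof. by rewrite !inE. Qed.

(* On each line [x + Z d] the last element of [M] is not in [shifted M]. *)
Lemma card_lines M : (#|` pi @` M| + #|` shifted M| <= #|` M|)%N.
Proof.
have sM : shifted M `<=` M by apply/fsubsetP=> x; rewrite in_shifted => /andP[].
rewrite -(cardfsID (shifted M) M) (fsetIidPr sM) addnC leq_add2l.
apply: leq_trans (card_image_le pi (M `\` shifted M)).
apply: fsubset_leq_card; apply/fsubsetP=> _ /imfsetP[x /= xM ->].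
have [|y + ymax] := @fset_argmax _ lam [fset y in M | pi y == pi x].
  by apply/fset0Pn; exists x; rewrite !inE xM eqxx.
rewrite !inE => /andP[yM /eqP yx]; apply/imfsetP; exists y => //=.
rewrite inE in_shifted yM /= andbT; apply/negP=> ydM.
have := ymax (y + d); rewrite !inE ydM pi_addd yx eqxx => /(_ isT).
by rewrite lamD gerDl leNgt lam_d.
Qed.


(** * Sets in a window of length [lam d] *)

Variables (A : {fset G}) (u : int) (a0 : G).
Hypothesis A_win : forall a, a \in A -> u <= lam a <= u + lam d.
Hypothesis a0A : a0 \in A.
Hypothesis a0dA : a0 + d \in A.

Let X := shifted A.
Let Ab := pi @` A.
Let m := #|` levels lam A|.

Let in_X x : (x \in X) = (x \in A) && (x + d \in A).
Proof. exact: in_shifted. Qed.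

Let lam_shifted x : x \in X -> lam x = u.
Proof.
rewrite in_X => /andP[/A_win ? /A_win]; rewrite lamD; lia.
Qed.

Let a0X : a0 \in X. Proof. by rewrite in_X a0A. Qed.
Let lam_a0 : lam a0 = u. Proof. exact: lam_shifted. Qed.

Let mem_Ab a : a \in A -> pi a \in Ab. Proof. by move=> aA; rewrite in_imfset. Qed.

Let AbP q : reflect (exists2 a, a \in A & q = pi a) (q \in Ab).
Proof. exact: imfsetP. Qed.

Lemma window_fiber a b : a \in A -> b \in A -> pi a = pi b -> [\/ a = b, a = b + d | b = a + d].
Proof.
move=> /A_win wa /A_win wb /piP[j E]; have := congr1 lam E.
rewrite lamB lam_mulz => Ej.
have j1 : -1 <= j by rewrite -(ler_pM2l lam_d) -Ej; move: wa wb; clear; lia.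
have j2 : j <= 1 by rewrite -(ler_pM2l lam_d) -Ej; move: wa wb; clear; lia.
have : j = 0 \/ j = 1 \/ j = -1 by move: j1 j2; clear; lia.
move: E => /[swap] -[->|[->|->]] /eqP; rewrite ?mulr0z ?mulr1z ?mulrN1z subr_eq.
- by rewrite add0r => /eqP->; constructor 1.
- by rewrite addrC => /eqP->; constructor 2.
by rewrite addrC eq_sym subr_eq => /eqP->; constructor 3.
Qed.

(** Of two elements of [A] with the same image, the lower one lies in [X]; hence [pi] is injective
    off [X]. *)
Lemma card_image_shifted : (#|` A| <= #|` Ab| + #|` X|)%N.
Proof.
have sX : X `<=` A by apply/fsubsetP=> x; rewrite in_X => /andP[].
rewrite -(cardfsID X A) (fsetIidPr sX) addnC leq_add2r.
have <- : #|` pi @` (A `\` X)| = #|` A `\` X|.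
  apply: card_in_imfset => a b /=; rewrite !in_fsetD !in_X => /andP[+ aA] /andP[+ bA].
  rewrite aA bA /= => na nb /(window_fiber aA bA)[] // E.
    by rewrite -E aA in nb.
  by rewrite -E bA in na.
by apply: fsubset_leq_card; apply/fsubsetP=> _ /imfsetP[x /= + ->]; rewrite inE => /andP[_ /mem_Ab].
Qed.

Lemma shifted_sumset Y : Y `<=` A -> add_coset a0 Y `<=` shifted (A :+: A).
Proof.
move=> /fsubsetP YA; apply/fsubsetP=> z; rewrite mem_coset => /YA zA.
have -> : z = a0 + (z - a0) by rewrite addrC subrK.
by rewrite in_shifted addrAC; apply/andP; split; apply: mem_sumset.
Qed.

(** As [a0] and [a0 + d] lie in [A], each element of [a0 + A] stays in [2A] after adding [d]. *)
Lemma card_double_image : (#|` Ab :+: Ab| + #|` A| <= #|` A :+: A|)%N.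
Proof.
apply: leq_trans (card_lines _); rewrite imfset_sumset leq_add2l -(card_coset a0 A).
by apply: fsubset_leq_card; apply: shifted_sumset.
Qed.

Lemma levels_transversal : exists Y : {fset G},
  [/\ Y `<=` A, #|` Y| = m & forall x y, x \in Y -> y \in Y -> lam x = lam y -> x = y].
Proof.
have ex v : exists x, v \in levels lam A -> x \in A /\ lam x = v.
  by have [/levelsP[x xA ->]|] := boolP (v \in levels lam A); [exists x|exists 0].
have [f fP] := choice ex.
exists [fset f v | v in levels lam A]; split.
- by apply/fsubsetP=> _ /imfsetP[v /= /fP[fA _] ->].
- rewrite card_in_imfset // => v w vl wl E.
  by rewrite -(proj2 (fP _ vl)) -(proj2 (fP _ wl)) E.
by move=> _ _ /imfsetP[v /= /fP[_ lv] ->] /imfsetP[w /= /fP[_ lw] ->]; rewrite lv lw => ->.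
Qed.

(** Let [Y] hold one element of each level and [Y1] omit the bottom one. As [X] lies on a single
    level, [X + Y] and [d + X + Y1] are direct sums; the former stays at levels up to [2u + lam d],
    the latter lies strictly above. Together they have [(2m - 1)|X|] elements. *)
Lemma card_ends : (2 * m * #|` X| <= #|` A :+: A| + #|` X|)%N.
Proof.
have [Y [YA cY Yinj]] := levels_transversal.
have /fsubsetP YA' := YA.
have sX : X `<=` A by apply/fsubsetP=> x; rewrite in_X => /andP[].
pose Y1 := [fset y in Y | lam y != u].
have cY1 : (#|` Y| <= #|` Y1| + 1)%N.
  have : (#|` [fset y in Y | lam y == u]| <= 1)%N.
    have [->|/fset0Pn[y]] := eqVneq [fset y in Y | lam y == u] fset0; first by rewrite cardfs0.
    rewrite !inE => /andP[yY /eqP yu]; rewrite -(cardfs1 y).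
    apply: fsubset_leq_card; apply/fsubsetP=> z; rewrite !inE => /andP[zY /eqP zu].
    by apply/eqP; apply: Yinj; rewrite ?zu.
  have -> : Y1 = Y `\` [fset y in Y | lam y == u].
    by apply/fsetP=> y; rewrite !inE; case: (y \in Y); rewrite ?andbT ?andbF.
  by have := cardfsID [fset y in Y | lam y == u] Y;
    have := fsubset_leq_card (fsubsetIr Y [fset y in Y | lam y == u]); card_lia.
have inj x x' y y' : x \in X -> x' \in X -> y \in Y -> y' \in Y ->
    x + y = x' + y' -> x = x' /\ y = y'.
  move=> xX x'X yY y'Y E; suff yy' : y = y' by move: E; rewrite yy' => /addIr.
  apply: Yinj => //; have := congr1 lam E; rewrite !lamD (lam_shifted xX) (lam_shifted x'X).
  exact: addrI.
have sY1 : Y1 `<=` Y by apply/fsubsetP=> y; rewrite !inE => /andP[].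
have c1 : #|` X :+: Y| = (#|` X| * m)%N by rewrite card_imfset2_inj // cY.
have c2 : #|` X :+: Y1| = (#|` X| * #|` Y1|)%N.
  by rewrite card_imfset2_inj // => x x' y y' ? ? /(fsubsetP sY1) ? /(fsubsetP sY1) ?; apply: inj.
have dj z : z \in X :+: Y -> z \in add_coset d (X :+: Y1) -> False.
  move=> /sumsetP[x [y [xX yY ->]]]; rewrite mem_coset => /sumsetP[x' [y' [x'X]]].
  rewrite !inE => /andP[y'Y /eqP y'u] /(congr1 lam).
  rewrite lamB !lamD (lam_shifted xX) (lam_shifted x'X).
  by move: y'u (A_win (YA' _ yY)) (A_win (YA' _ y'Y)); clear; lia.
have : (#|` (X :+: Y) `|` add_coset d (X :+: Y1)| <= #|` A :+: A|)%N.
  apply: fsubset_leq_card; rewrite fsubUset sumsetS //=.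
  apply/fsubsetP=> z; rewrite mem_coset => /sumsetP[x [y [xX yY E]]].
  have yA := YA' _ (fsubsetP sY1 _ yY).
  rewrite -[z](subrK d) E addrAC mem_sumset //.
  by move: xX; rewrite in_X => /andP[].
rewrite card_disjU // card_coset c1 c2; rewrite cY in cY1; move: cY1.
by generalize m #|` Y1| #|` X| #|` A :+: A| => *; nia.
Qed.

Hypothesis small : (m * #|` A :+: A| + 3 * #|` A| < 3 * m * #|` A|)%N.

(** With two levels, [card_ends] gives [3|X| <= |2A|] and counting modulo [d] gives
    [2|A| - |X| <= |2A|]; together [2|2A| >= 3|A|], which [small] excludes. *)
Lemma levels_ge3 : (2 < m)%N.
Proof.
have h1 := card_ends; have h2 := card_double_image.
have h3 : (#|` Ab| <= #|` Ab :+: Ab|)%N.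
  by apply: card_sumset_ge; apply/fset0Pn; exists (pi a0); apply: mem_Ab.
have h4 := card_image_shifted.
have h5 : (1 < m)%N.
  suff : (#|` [fset lam a0; lam (a0 + d)%R]| <= m)%N.
    rewrite cardfs2 lamD -subr_eq0 opprD addrA subrr sub0r oppr_eq0 gt_eqF //.
  apply: fsubset_leq_card; apply/fsubsetP=> v; rewrite !inE => /orP[] /eqP->; exact: mem_levels.
rewrite ltnNge; apply/negP => le2; have E : (m = 2)%N by apply/eqP; rewrite eqn_leq le2.
by move: h1 h2 h3 h4 small; rewrite E; clear; card_lia.
Qed.

Lemma ends_small : (2 * m * #|` X| < 3 * #|` A|)%N.
Proof.
have := card_ends; have := levels_ge3; move: small.
by generalize m #|` A| #|` X| #|` A :+: A| => m' a x s *; nia.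
Qed.

(** * Classes modulo the periods of the doubled image *)

Let S2 := Ab :+: Ab.
Let H := stab S2.
Let N := #|` Ab :+: H|.
Let C0 := add_coset (pi a0) (Ab :+: H).
Let cls y : {fset G} := [fset a in A | pi a - pi y \in H].

Let in_cls y a : (a \in cls y) = (a \in A) && (pi a - pi y \in H).
Proof. by rewrite !inE. Qed.

Let Ab_neq0 : Ab != fset0.
Proof. by apply/fset0Pn; exists (pi a0); apply: mem_Ab. Qed.

Let sH : is_subgroup H.
Proof. by apply: stab_sg; apply: sumset_neq0. Qed.

Let S2H : S2 :+: H = S2.
Proof. by apply: stab_period; apply: sumset_neq0. Qed.

Let kneser_image : (2 * N <= #|` S2| + #|` H|)%N.
Proof. by have := kneser Ab_neq0 Ab_neq0; rewrite /kneser_bound addnn -mul2n. Qed.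

Let mem_C0 x : (x \in C0) = (x - pi a0 \in Ab :+: H).
Proof. exact: mem_coset. Qed.

Let C0_period x y : x \in C0 -> y - x \in H -> y \in C0.
Proof.
rewrite !mem_C0 => xC yx; apply: (period_mem (sumsetKK Ab sH) xC).
by rewrite opprB addrA subrK.
Qed.

Let S2P q : reflect (exists2 z, z \in A :+: A & q = pi z) (q \in S2).
Proof. by rewrite /S2 -imfset_sumset; apply: imfsetP. Qed.

(** Three disjoint parts of [2A] are counted. Over [C0], which lies in [S2], there are at least
    [N + |A|] elements, by [card_lines] and the shiftable set [a0 + A]; over the class of [y1 + y2]
    there are [|W|]; over the rest of [S2], at least one per point. Then [|S2| >= 2N - |H|] is
    inserted. *)
Lemma double_count y1 y2 (W := [fset z in A :+: A | pi z - pi (y1 + y2) \in H]) :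
  pi (y1 + y2) \notin C0 -> (2 * N + #|` A| + #|` W| <= #|` A :+: A| + 2 * #|` H|)%N.
Proof.
move=> yC; pose Z := [fset z in A :+: A | pi z \in C0].
have inZ z : (z \in Z) = (z \in A :+: A) && (pi z \in C0) by rewrite !inE.
have inW z : (z \in W) = (z \in A :+: A) && (pi z - pi (y1 + y2) \in H) by rewrite !inE.
have cZ : (N + #|` A| <= #|` Z|)%N.
  apply: leq_trans (card_lines _); apply: leq_add.
    rewrite /N -(card_coset (pi a0) (Ab :+: H)); apply: fsubset_leq_card.
    apply/fsubsetP=> q qC; have : q \in S2.
      move: (qC); rewrite mem_C0 => /mem_sumK[_ /AbP[a aA ->] qa].
      apply: (period_mem S2H (mem_sumset (mem_Ab a0A) (mem_Ab aA))).
      by rewrite opprD addrA.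
    by case/S2P=> z zAA Eq; apply/imfsetP; exists z => //=; rewrite inZ zAA -Eq.
  rewrite -(card_coset a0 A); apply: fsubset_leq_card; apply/fsubsetP=> z zA.
  have := fsubsetP (shifted_sumset (fsubset_refl A)) _ zA.
  rewrite !in_shifted !inZ pi_addd => /andP[-> ->] /=; rewrite andbb mem_C0 -(raddfB pi).
  by apply: (fsubsetP (sub_sumK _ sH)); apply: mem_Ab; rewrite -mem_coset.
have dj z : z \in Z -> z \in W -> False.
  rewrite inZ inW => /andP[_ zC] /andP[_ zy]; move/negP: yC; apply.
  by apply: (C0_period zC); rewrite sgBC.
have cS2 : (#|` S2| <= #|` (A :+: A) `\` (Z `|` W)| + (N + #|` H|))%N.
  apply: (@leq_trans #|` pi @` ((A :+: A) `\` (Z `|` W)) `|` (C0 `|` add_coset (pi (y1 + y2)) H)|).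
    apply: fsubset_leq_card; apply/fsubsetP=> _ /S2P[z zAA ->].
    rewrite !in_fsetU (mem_coset (pi (y1 + y2))).
    case: (boolP (pi z \in C0)) => [_|zC]; first by rewrite /= orbT.
    case: (boolP (pi z - pi (y1 + y2) \in H)) => [_|zy]; first by rewrite /= orbT.
    by rewrite /= orbF; apply/imfsetP; exists z; rewrite //= in_fsetD in_fsetU inZ inW zAA /= negb_or zC zy.
  apply: leq_trans (cardfsU_le _ _) _; apply: leq_add; first exact: card_image_le.
  by apply: leq_trans (cardfsU_le _ _) _; rewrite !card_coset.
have sZW : Z `|` W `<=` A :+: A.
  by apply/fsubsetP=> z; rewrite in_fsetU inZ inW => /orP[] /andP[].
have := cardfsID (Z `|` W) (A :+: A); rewrite (fsetIidPr sZW) (card_disjU dj).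
by move: cZ cS2 kneser_image; rewrite -/N; generalize N; card_lia.
Qed.

Lemma class_gap K y : is_subgroup K -> K `<=` H -> y \in A ->
  (#|` Ab :+: K| + #|` H| <= N + #|` (pi @` cls y) :+: K|)%N.
Proof.
move=> sK KH yA; apply: leq_trans (part_gap sH sK KH (mem_Ab yA)) _.
rewrite leq_add2l (_ : part H Ab (pi y) = pi @` cls y) //; apply/fsetP=> q.
rewrite in_part; apply/andP/imfsetP => [[/AbP[a aA ->] ay]|[a /=]].
  by exists a; rewrite //= in_cls aA.
by rewrite in_cls => /andP[aA ay] ->; rewrite mem_Ab.
Qed.

Lemma class_size y : y \in A -> (#|` Ab| + #|` H| <= N + #|` pi @` cls y|)%N.
Proof.
move=> yA; have s0 : is_subgroup [fset (0 : Q)].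
  by split=> [|a b]; rewrite !inE // => /eqP-> /eqP->; rewrite subrr.
have := class_gap s0 _ yA; rewrite !sumset0; apply.
by apply/fsubsetP=> x; rewrite inE => /eqP->; apply: sg0.
Qed.

(** If every [pi (x + y)] were in [C0], then [pi x - pi a0] would translate [pi A] into [pi A + H]
    and so be a period of [S2]. *)
Lemma outside x : pi x - pi a0 \notin H -> exists2 y, y \in A & pi (x + y) \notin C0.
Proof.
move=> xa; apply: contrapT => nex; move/negP: xa; apply; apply/stabP.
  exact: sumset_neq0.
move=> _ /sumsetP[_ [_ [/AbP[y yA ->] /AbP[z zA ->] ->]]].
have : pi (x + y) \in C0 by apply: contrapT => /negP yC; apply: nex; exists y.
rewrite mem_C0 (raddfD pi) => /mem_sumK[_ /AbP[w wA ->]] h.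
apply: (period_mem S2H (mem_sumset (mem_Ab wA) (mem_Ab zA))).
have -> : pi x - pi a0 + (pi y + pi z) - (pi w + pi z) = pi x + pi y - pi a0 - pi w => //.
by rewrite opprD !addrA [_ + pi z - pi w]addrAC addrK [_ - pi a0 + pi y]addrAC.
Qed.

Lemma outside_class x y : x \in A -> pi (x + y) \notin C0 -> pi y - pi a0 \notin H.
Proof.
move=> xA; apply: contra => ya; rewrite mem_C0 (raddfD pi); apply/mem_sumK; exists (pi x).
  exact: mem_Ab.
by rewrite addrAC [pi x + _]addrC addrK.
Qed.

Let in_W y1 y2 x y : x \in A -> y \in A -> pi x - pi y1 \in H -> pi y - pi y2 \in H ->
  x + y \in [fset z in A :+: A | pi z - pi (y1 + y2) \in H].
Proof.
move=> xA yA x1 y2'; rewrite in_filter mem_sumset //= !(raddfD pi) opprD addrACA.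
exact: sgD.
Qed.

(** Otherwise both [x] and [x + d] translate some [cls y] into the part [W] of [2A] outside [C0], so
    [|W| >= 2 |pi (cls y)|]. Then [|2A| >= |A| + 2|pi A| >= 3|A| - 2|X|], against [ends_arith]. *)
Lemma ends_in_class x : x \in X -> pi x - pi a0 \in H.
Proof.
move=> xX; apply: contraT => xa; have [y yA xyC] := outside xa.
have := double_count xyC; set W := [fset z in _ | _].
have := xX; rewrite in_X => /andP[xA xdA].
have xW z : z \in cls y -> x + z \in W /\ x + z + d \in W.
  rewrite in_cls => /andP[zA zy]; rewrite addrAC; split; apply: in_W => //.
    by rewrite subrr sg0.
  by rewrite pi_addd subrr sg0.
have : (2 * #|` pi @` cls y| <= #|` W|)%N.
  rewrite mul2n -addnn; apply: leq_trans (card_lines _); apply: leq_add.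
    rewrite -(card_coset (pi x) (pi @` cls y)); apply: fsubset_leq_card; apply/fsubsetP=> q.
    rewrite mem_coset => /imfsetP[z /= /xW[zW _] E]; apply/imfsetP; exists (x + z) => //=.
    by rewrite (raddfD pi) -E addrC subrK.
  apply: leq_trans (card_image_le pi _) _; rewrite -(card_coset x (cls y)).
  apply: fsubset_leq_card; apply/fsubsetP=> z; rewrite mem_coset => /xW.
  by rewrite addrC subrK in_shifted => -[-> ->].
have := class_size yA; have := card_image_shifted; have := ends_small; move: small.
move=> small1 small2 c1 c2 c3 c4; have := ends_arith small1 small2.
by move: c1 c2 c3 c4; rewrite -/N; generalize N; card_lia.
Qed.

(** The point is finiteness. An element of [H] is a difference of two points of [S2], so its lifts
    are [x - y - d *~ j] with [x], [y] in [2A], and level zero determines [j]. *)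
Lemma kernel_exists : exists K : {fset G}, forall g, (g \in K) = (pi g \in H) && (lam g == 0).
Proof.
pose T := [fset x - y - d *~ (lam (x - y) %/ lam d)%Z | x in A :+: A, y in A :+: A].
exists [fset g in T | (pi g \in H) && (lam g == 0)] => g; rewrite in_filter /=.
apply/andP/idP => [[]//|gP]; split=> //; have /andP[gH /eqP lg] := gP.
apply/imfset2P.
have /fset0Pn[q qS] : S2 != fset0 by apply: sumset_neq0.
have /S2P[y yA Eq] := qS.
have /(stabP _ (sumset_neq0 Ab_neq0 Ab_neq0))/(_ _ qS)/S2P[x xA Ex] := gH.
exists x => //; exists y => //=.
have /piP[j E] : pi (x - y) = pi g by rewrite (raddfB pi) -Ex -Eq addrK.
have -> : lam (x - y) = j * lam d.
  by have := congr1 lam E; rewrite lamB lg subr0 lam_mulz mulrC.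
rewrite mulzK ?gt_eqF // -E opprB addrC subrK.
by [].
Qed.

(** * The kernel of [lam] above the period group *)

Variable K : {fset G}.
Hypothesis KP : forall g, (g \in K) = (pi g \in H) && (lam g == 0).

Let kappa := #|` K|.
Let Kb := pi @` K.

Let inK g : pi g \in H -> lam g = 0 -> g \in K.
Proof. by move=> gH lg; rewrite KP gH lg eqxx. Qed.

Let KH g : g \in K -> pi g \in H.
Proof. by rewrite KP => /andP[]. Qed.

Let K0 g : g \in K -> lam g = 0.
Proof. by rewrite KP => /andP[_ /eqP]. Qed.

Lemma kernel_sg : is_subgroup K.
Proof.
split=> [|x y xK yK]; first by apply: inK; rewrite raddf0 //; apply: sg0.
apply: inK; first by rewrite (raddfB pi); apply: sgB => //; apply: KH.
by rewrite lamB !K0.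
Qed.
Let sK := kernel_sg.

Let sKb : is_subgroup Kb.
Proof.
split=> [|_ _ /imfsetP[x /= xK ->] /imfsetP[y /= yK ->]].
  by rewrite -(raddf0 pi) in_imfset //=; apply: sg0.
by rewrite -(raddfB pi) in_imfset //=; apply: sgB.
Qed.

Let KbH : Kb `<=` H.
Proof. by apply/fsubsetP=> _ /imfsetP[x /= /KH xK ->]. Qed.

Lemma card_kernel_le : (kappa <= #|` H|)%N.
Proof.
rewrite (_ : kappa = #|` Kb|); first exact: fsubset_leq_card.
apply/esym; apply: card_in_imfset => x y /= xK yK E.
by apply: pi_level_inj E _; rewrite !K0.
Qed.

Lemma card_ends_le : (#|` X| <= kappa)%N.
Proof.
rewrite /kappa -(card_coset a0 K); apply: fsubset_leq_card; apply/fsubsetP=> x xX.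
rewrite mem_coset; apply: inK; first by rewrite (raddfB pi) ends_in_class.
by rewrite lamB lam_a0 (lam_shifted xX) subrr.
Qed.

(** One lift is chosen for each level except the top one and translated by [K]. The remaining levels
    lie in a half-open window of length [lam d], so these translates stay distinct modulo [d]. *)
Lemma card_levels_le (Y : {fset Q}) : Y :+: Kb = Y ->
  (forall a, a \in A -> lam a < u + lam d -> exists2 g, lam g = lam a & pi g \in Y) ->
  (m * kappa <= #|` Y| + kappa)%N.
Proof.
move=> YK lift; pose V := [fset v in levels lam A | v != u + lam d].
have cV : (m <= #|` V| + 1)%N.
  have sV : levels lam A `<=` V `|` [fset u + lam d].
    by apply/fsubsetP=> v vA; rewrite in_fsetU in_filter vA inE /= orNb.
  by apply: leq_trans (fsubset_leq_card sV) _; apply: leq_trans (cardfsU_le _ _) _; rewrite cardfs1.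
have Vw v : v \in V -> u <= v < u + lam d.
  by rewrite in_filter => /andP[/levelsP[a /A_win aw ->] ne]; lia.
have ex v : exists g, v \in V -> lam g = v /\ pi g \in Y.
  have [vV|] := boolP (v \in V); last by exists 0.
  have := Vw _ vV; have := vV; rewrite in_filter => /andP[/levelsP[a aA ->] _] /andP[_ lt].
  by have [g lg gY] := lift a aA lt; exists g.
have [f fP] := choice ex.
suff : (#|` V| * kappa <= #|` Y|)%N by move: cV; rewrite /kappa; nia.
rewrite /kappa -(@card_imfset2_inj _ _ _ (fun v k => pi (f v + k)) V K).
  apply: fsubset_leq_card; apply/fsubsetP=> _ /imfset2P[v /= /fP[_ vY] [k /= kK ->]].
  by rewrite -YK (raddfD pi) mem_sumset //= in_imfset.
move=> v v' k k' vV v'V kK k'K /piP[j E].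
have [lv _] := fP _ vV; have [lv' _] := fP _ v'V.
have Ej : v - v' = lam d * j.
  by have := congr1 lam E; rewrite lamB !lamD lam_mulz lv lv' (K0 kK) (K0 k'K) !addr0.
have w := Vw _ vV; have w' := Vw _ v'V.
have j1 : -1 < j by rewrite -(ltr_pM2l lam_d) -Ej; move: w w'; clear; lia.
have j2 : j < 1 by rewrite -(ltr_pM2l lam_d) -Ej; move: w w'; clear; lia.
have j0 : j = 0 by move: j1 j2; clear; lia.
have vv' : v = v' by apply/eqP; rewrite -subr_eq0 Ej j0 mulr0.
split=> //; move: E; rewrite j0 mulr0z vv' => /eqP; rewrite subr_eq0 => /eqP.
exact: addrI.
Qed.

(* Otherwise the translates of a class by [x] and by [y] overlap in at most
   [kappa / 2] elements, which makes 2A too large. *)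
Lemma no_split x y : x \in A -> y \in A -> lam x = u -> lam y = u + lam d ->
  pi y - pi x \in H -> pi x - pi a0 \in H.
Proof.
move=> xA yA xu yu yx; apply: contraT => xa; exfalso; have [z zA xzC] := outside xa.
have := double_count xzC; set W := [fset w in _ | _] => cW.
have za := outside_class xA xzC.
pose P := add_coset x (cls z) `&` add_coset y (cls z).
have PP w : w \in P -> [/\ w - x \in cls z, lam (w - x) = u + lam d,
    w - y \in cls z & lam (w - y) = u].
  rewrite in_fsetI !mem_coset => /andP[wx wy].
  have /A_win : w - x \in A by move: wx; rewrite in_cls => /andP[].
  have /A_win : w - y \in A by move: wy; rewrite in_cls => /andP[].
  rewrite !lamB xu yu => /andP[ly _] /andP[_ lx].
  by split => //; move: ly lx; clear; lia.
(* The sets [P - y] and [P - x - d] lie on level [u] in one coset of [K]. A common element [v] would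
   have [v] and [v + d] in [A], so [v] would be in [X] and in the class of [z], against
   [ends_in_class]. *)
have cP : (2 * #|` P| <= kappa)%N.
  have [->|/fset0Pn[w0 w0P]] := eqVneq P fset0; first by rewrite cardfs0.
  have [_ _ b0 bu] := PP _ w0P; set b := w0 - y in b0 bu.
  have bz : pi b - pi z \in H by move: b0; rewrite in_cls => /andP[].
  rewrite mul2n -addnn -{1}(card_coset (- y) P) -(card_coset (- x - d) P) -card_disjU.
    rewrite /kappa -(card_coset b K); apply: fsubset_leq_card; apply/fsubsetP=> v.
    rewrite in_fsetU !mem_coset opprB !opprK => /orP[] /PP.
      rewrite addrK !in_cls => -[_ _ /andP[vA vz] vu]; apply: inK.
        by rewrite (raddfB pi) (sg_trans sH vz) // sgBC.
      by rewrite lamB vu bu subrr.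
    have -> : v + (d + x) - x = v + d by rewrite addrA addrK.
    rewrite in_cls => -[/andP[vA vz] vu _ _]; apply: inK.
      by rewrite (raddfB pi) (sg_trans sH (y := pi z)) // -?(pi_addd v) // sgBC.
    by move: vu; rewrite lamB lamD bu; clear; lia.
  move=> v; rewrite !mem_coset opprB !opprK => /PP[_ _ + _] /PP[+ _ _ _].
  have -> : v + (d + x) - x = v + d by rewrite addrA addrK.
  rewrite addrK !in_cls => /andP[vA vz] /andP[vdA _]; move/negP: za; apply.
  have vX : v \in X by rewrite in_X vA.
  by apply: (sg_trans sH (y := pi v)); [rewrite sgBC|apply: ends_in_class].
have cPW : (2 * #|` cls z| <= #|` W| + #|` P|)%N.
  rewrite mul2n -addnn -{1}(card_coset x (cls z)) -(card_coset y (cls z)) -cardfsUI leq_add2r.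
  apply: fsubset_leq_card; apply/fsubsetP=> w; rewrite in_fsetU !mem_coset.
  have x0 : pi x - pi x \in H by rewrite subrr sg0.
  by move=> /orP[]; rewrite in_cls => /andP[wA wz];
    [rewrite -(subrK x w)|rewrite -(subrK y w)]; rewrite addrC; apply: in_W.
(* The class of [x] can be deleted from [pi A + H] without losing a level: an element [a] of that
   class is replaced by [a - x + a0], which has the same level and lies over the class of [a0]. *)
have cY : (m * kappa + #|` H| <= N + kappa)%N.
  have sY : add_coset (pi x) H `<=` Ab :+: H.
    apply/fsubsetP=> q; rewrite mem_coset => qx; apply/mem_sumK; exists (pi x) => //.
    exact: mem_Ab.
  have := @card_levels_le ((Ab :+: H) `\` add_coset (pi x) H).
  rewrite cardfsDS // card_coset -/N => cl.
  have HN : (#|` H| <= N)%N by rewrite -(card_coset (pi x) H); apply: fsubset_leq_card.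
  suff : (m * kappa <= N - #|` H| + kappa)%N by move: HN; rewrite /kappa; generalize N m; card_lia.
  apply: cl.
    apply/eqP; rewrite eqEfsubset (sub_sumK _ sKb) andbT; apply/fsubsetP=> q /mem_sumK[w].
    rewrite !in_fsetD !mem_coset => /andP[wx wA] /(fsubsetP KbH) qw.
    rewrite (period_mem (sumsetKK Ab sH) wA qw) andbT; apply: contra wx => qx.
    by rewrite (sg_trans sH (y := q)) // sgBC.
  move=> a aA _; have [ax|ax] := boolP (pi a - pi x \in H).
    exists (a - x + a0); first by rewrite lamD lamB xu lam_a0 subrK.
    rewrite in_fsetD mem_coset (raddfD pi) (raddfB pi); apply/andP; split.
      apply: contra xa => h; rewrite sgBC //.
      have -> : pi a0 - pi x = (pi a - pi x + pi a0 - pi x) - (pi a - pi x).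
        by rewrite -[_ + pi a0 - _]addrA [_ + (pi a0 - _)]addrC addrK.
      exact: sgB.
    by apply/mem_sumK; exists (pi a0); rewrite ?mem_Ab // addrK.
  exists a => //; rewrite in_fsetD mem_coset ax /=.
  by apply: (fsubsetP (sub_sumK _ sH)); apply: mem_Ab.
have c1 := class_size zA; have c2 := card_image_le pi (cls z).
have c3 := card_double_image; have c4 := kneser_image.
apply: (split_arith small ends_small levels_ge3 card_image_shifted card_ends_le card_kernel_le cP _ cY).
  by move: c3 c4; rewrite -/S2; generalize N; card_lia.
by move: c1 c2 cPW cW; rewrite -/N; generalize N; card_lia.
Qed.

(** By [no_split] no two levels of the class differ by [lam d], so [pi] is injective on [cls y + K],
    and the image lies in one coset of [H]. *)
Lemma class_sumK_le y : pi y - pi a0 \notin H -> (#|` cls y :+: K| <= #|` H|)%N.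
Proof.
move=> ya.
have gap c c' : c \in cls y -> c' \in cls y -> lam c - lam c' <> lam d.
  rewrite !in_cls => /andP[cA cy] /andP[c'A c'y] E; move/negP: ya; apply.
  have [lc lc'] : lam c = u + lam d /\ lam c' = u.
    by have := A_win cA; have := A_win c'A; move: E; clear; lia.
  apply: (sg_trans sH (y := pi c')); first by rewrite sgBC.
  by apply: (no_split c'A cA) => //; rewrite (sg_trans sH cy) // sgBC.
have <- : #|` pi @` (cls y :+: K)| = #|` cls y :+: K|.
  apply: card_in_imfset => _ _ /= /sumsetP[c [k [cC kK ->]]] /sumsetP[c' [k' [c'C k'K ->]]] E.
  have /piP[j Ej] := E; apply: (pi_level_inj E); apply/eqP; rewrite -subr_eq0; apply/eqP.
  have Ec : lam c - lam c' = lam d * j.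
    by have := congr1 lam Ej; rewrite lamB !lamD lam_mulz (K0 kK) (K0 k'K) !addr0.
  have /A_win wc : c \in A by move: cC; rewrite in_cls => /andP[].
  have /A_win wc' : c' \in A by move: c'C; rewrite in_cls => /andP[].
  have j1 : -1 <= j by rewrite -(ler_pM2l lam_d) -Ec; move: wc wc'; clear; lia.
  have j2 : j <= 1 by rewrite -(ler_pM2l lam_d) -Ec; move: wc wc'; clear; lia.
  have [j0|[j0|j0]] : j = 0 \/ j = 1 \/ j = -1 by move: j1 j2; clear; lia.
  - by rewrite !lamD (K0 kK) (K0 k'K) !addr0 Ec j0 mulr0.
  - by case: (gap c c' cC c'C); rewrite Ec j0 mulr1.
  by case: (gap c' c c'C cC); rewrite -opprB Ec j0 mulrN1 opprK.
rewrite -(card_coset (pi y) H); apply: fsubset_leq_card.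
apply/fsubsetP=> _ /imfsetP[_ /= /sumsetP[c [k [+ kK ->]]] ->].
rewrite in_cls mem_coset (raddfD pi) addrAC => /andP[_ cy].
by apply: sgD => //; apply: KH.
Qed.

(** If [N > |H|], Kneser's bound makes [S2] larger than [C0], so some [pi (y1 + y2)] is outside
    [C0]. The classes of [y1] and [y2] both differ from that of [a0], hence [card_sumset_levels]
    applies to their sum, which lies in [W]. *)
Lemma single_class : (N <= #|` H|)%N.
Proof.
rewrite leqNgt; apply/negP => ltN.
have [q /S2P[_ /sumsetP[y1 [y2 [y1A y2A ->]]] ->] yC] : exists2 q, q \in S2 & q \notin C0.
  apply/fsubsetPn; apply/negP=> /fsubset_leq_card; rewrite card_coset -/N.
  by move: kneser_image ltN; generalize N; card_lia.
have := double_count yC; set W := [fset w in _ | _] => cW.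
have y1a : pi y1 - pi a0 \notin H by apply: (outside_class y2A); rewrite addrC.
have y2a := outside_class y1A yC.
pose C := cls y1; pose D := cls y2.
have CW : C :+: D `<=` W.
  apply/fsubsetP=> _ /sumsetP[c [e [+ + ->]]]; rewrite !in_cls => /andP[cA c1] /andP[eA e2].
  exact: in_W.
have C_neq0 : C != fset0 by apply/fset0Pn; exists y1; rewrite in_cls y1A subrr sg0.
have D_neq0 : D != fset0 by apply/fset0Pn; exists y2; rewrite in_cls y2A subrr sg0.
have compat : level_compat lam K (C :+: D).
  have WH z : z \in W -> pi z - pi (y1 + y2) \in H by rewrite in_filter => /andP[].
  move=> z w /(fsubsetP CW)/WH zy /(fsubsetP CW)/WH wy zw.
  apply: inK; first by rewrite (raddfB pi) (sg_trans sH zy) // sgBC.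
  by rewrite lamB zw subrr.
have c1 := class_size y1A; have c2 := class_size y2A.
have i1 := card_image_le pi C; have i2 := card_image_le pi D.
have k1 := class_sumK_le y1a; have k2 := class_sumK_le y2a.
have basic : (2 * (N - #|` Ab|) < #|` H|)%N.
  apply: (hole_arith small ends_small card_image_shifted).
    exact: fsubset_leq_card (sub_sumK _ sH).
  by have := card_double_image; move: kneser_image; rewrite -/S2; generalize N; card_lia.
have lev : (#|` C| + #|` D :+: K| <= #|` C :+: D| + #|` K|)%N.
  apply: (card_sumset_levels sK K0 C_neq0 D_neq0 compat);
    by move: k1 k2 c1 c2 i1 i2 basic; rewrite -/N -/C -/D; generalize N; card_lia.
have gap := class_gap sKb KbH y2A; have i3 := card_image_le pi (D :+: K).
rewrite imfset_sumset -/Kb in i3; have cCW := fsubset_leq_card CW.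
have cE := @card_levels_le (Ab :+: Kb) (sumsetKK Ab sKb).
(* What remains is [|A| + |pi A| + |pi A + pi K| <= |2A| + |K|]: the lower bounds for [|C|] and
   [|D + K|] each involve [|H| - N], and these terms cancel against [double_count]. *)
apply: (class_arith small levels_ge3 card_image_shifted card_ends_le _ (cE _)).
- exact: fsubset_leq_card (sub_sumK _ sKb).
- by move=> a aA _; exists a => //; apply: (fsubsetP (sub_sumK _ sKb)); apply: mem_Ab.
by move: c1 i1 lev gap i3 cCW cW; rewrite -/N -/C -/D /kappa; generalize N; card_lia.
Qed.

Lemma in_single_class a : a \in A -> pi a - pi a0 \in H.
Proof.
move=> aA; rewrite -mem_coset (_ : add_coset (pi a0) H = Ab :+: H).
  by apply: (fsubsetP (sub_sumK _ sH)); apply: mem_Ab.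
apply/eqP; rewrite eqEfcard card_coset single_class andbT; apply/fsubsetP=> q.
by rewrite mem_coset => qa; apply/mem_sumK; exists (pi a0); rewrite // mem_Ab.
Qed.

(** Take [p] of least positive level above [H]. Division by [lam p] shows that the preimage of [H]
    consists of the multiples of [p] plus [K]. With [L = lam d / lam p], the elements [p *+ j + k]
    for [j < L] are distinct modulo [d], so [L |K| <= |H| <= |2A| - |A|]. *)
Lemma lines_structure : exists (p : G) (L : nat),
  [/\ 0 < lam p, forall a, a \in A -> exists2 j, (j <= L)%N & a - a0 - p *+ j \in K,
   (1 < L)%N & (L * kappa + #|` A| <= #|` A :+: A|)%N].
Proof.
have exg : exists n : nat, `[< exists2 p, pi p \in H & lam p = n.+1%:Z >].
  exists `|lam d|.-1; apply/asboolP; exists d; first by rewrite pi_d sg0.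
  by move: lam_d; clear; lia.
case: (ex_minnP exg) => g /asboolP[p pH lp] gmin; have lp0 : 0 < lam p by rewrite lp.
have pmul z : pi (p *~ z) \in H.
  rewrite (raddfMz pi); case: z => n.
    by elim: n => [|n IHn]; rewrite ?mulr0z ?sg0 // intS mulrzDr mulr1z sgD.
  apply: sgN => //.
  by elim: n => [|n IHn]; rewrite ?mulr1n // mulrS sgD.
have lpmul z : lam (p *~ z) = lam p * z by rewrite (raddfMz lam) mulrzz.
have divp x : pi x \in H -> x - p *~ (lam x %/ lam p)%Z \in K.
  move=> xH; set y := x - _; have yH : pi y \in H by rewrite (raddfB pi) sgB.
  have ly : lam y = (lam x %% lam p)%Z.
    by apply/eqP; rewrite lamB lpmul subr_eq addrC [lam p * _]mulrC -divz_eq.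
  apply: inK => //; apply/eqP; apply/negPn/negP => ly0.
  have y0 : 0 <= lam y by rewrite ly modz_ge0 // gt_eqF.
  have ylt : lam y < lam p by rewrite ly ltz_pmod.
  have : (g <= `|lam y|.-1)%N.
    by apply: gmin; apply/asboolP; exists y => //; move: y0 ly0; clear; lia.
  by move: ylt y0 ly0; rewrite lp; clear; lia.
pose L := `|(lam d %/ lam p)%Z|%N.
have divd0 : 0 <= (lam d %/ lam p)%Z by rewrite divz_ge0 // ltW.
have lamdE : lam d = lam p * L%:Z.
  have := K0 (divp d _); rewrite pi_d sg0 // => /(_ isT).
  by rewrite lamB lpmul /L gez0_abs // => /eqP; rewrite subr_eq0 => /eqP.
have steps a : a \in A -> exists2 j, (j <= L)%N & a - a0 - p *+ j \in K.
  move=> aA; have := divp (a - a0); rewrite (raddfB pi) in_single_class // => /(_ isT).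
  rewrite lamB lam_a0 => aK; have /andP[wa wa'] := A_win aA.
  have j0 : 0 <= ((lam a - u) %/ lam p)%Z by rewrite divz_ge0 // subr_ge0.
  exists `|((lam a - u) %/ lam p)%Z|%N.
    rewrite -lez_nat gez0_abs // -(ler_pM2l lp0) -lamdE.
    have := divz_eq (lam a - u) (lam p); have := modz_ge0 (lam a - u) (lt0r_neq0 lp0).
    by move: wa'; rewrite mulrC; clear; lia.
  by rewrite pmulrn gez0_abs.
exists p, L; split=> //.
  (* The levels of [A] are among the [L + 1] values [u + j lam p], and there are at least three of
     them. *)
  have : levels lam A `<=` [fset (u + lam p * j%:Z)%R | j in iota 0 L.+1].
    apply/fsubsetP=> _ /levelsP[a aA ->]; have [j jL /K0] := steps _ aA.
    rewrite !lamB pmulrn lpmul lam_a0 => /eqP; rewrite subr_eq0 subr_eq addrC => /eqP E.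
    by apply/imfsetP; exists j => //; rewrite [_ \in _]mem_iota add0n ltnS.
  move=> /fsubset_leq_card le; rewrite -ltnS; apply: leq_trans levels_ge3 _.
  by apply: leq_trans le _; apply: card_iota_image.
have HS2 : (#|` H| <= #|` S2|)%N by have := card_sumset_ge H (sumset_neq0 Ab_neq0 Ab_neq0); rewrite S2H.
suff : (L * kappa <= #|` H|)%N.
  by have := card_double_image; move: HS2; rewrite -/S2 /kappa; generalize (L * #|` K|)%N; card_lia.
have -> : (L * kappa)%N = (#|` [fset j in iota 0 L]| * #|` K|)%N.
  by rewrite card_fseq undup_id ?iota_uniq // size_iota.
rewrite -(card_imfset2_inj (f := fun j k => pi (p *+ j + k))).
  apply: fsubset_leq_card; apply/fsubsetP=> _ /imfset2P[j _ [k /= kK ->]].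
  by rewrite (raddfD pi); apply: sgD => //; [rewrite pmulrn; apply: pmul|apply: KH].
move=> j j' k k'; rewrite !inE !mem_iota /= add0n => jL j'L kK k'K E.
have /piP[z Ez] := E.
have Ej : j%:Z - j'%:Z = L%:Z * z.
  apply: (mulfI (lt0r_neq0 lp0)); rewrite mulrA -lamdE mulrBr -lam_mulz -Ez.
  by rewrite lamB !lamD !pmulrn !lpmul (K0 kK) (K0 k'K) !addr0.
have L0 : 0 < L%:Z by move: jL; clear; lia.
have z1 : -1 < z by rewrite -(ltr_pM2l L0) -Ej; move: jL j'L; clear; lia.
have z2 : z < 1 by rewrite -(ltr_pM2l L0) -Ej; move: jL j'L; clear; lia.
have z0 : z = 0 by move: z1 z2; clear; lia.
have jj' : j = j' by move: Ej; rewrite z0 mulr0; clear; lia.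
split=> //; move: Ez; rewrite z0 mulr0z jj' => /eqP; rewrite subr_eq0 => /eqP.
exact: addrI.
Qed.

End Lines.

(** * The structure theorem *)

Theorem rank_one_structure (G : zmodType) (lam : {additive G -> int}) (A : {fset G})
    (m := #|` levels lam A|) :
  (m * #|` A :+: A| + 3 * #|` A| < 3 * m * #|` A|)%N ->
  exists (c p : G) (L : nat) (K : {fset G}),
   [/\ is_subgroup K /\ (forall k, k \in K -> lam k = 0), 0 < lam p,
    forall a, a \in A -> exists2 j, (j <= L)%N & a - c - p *+ j \in K,
   (1 < L)%N & (L * #|` K| + #|` A| <= #|` A :+: A|)%N].
Proof.
move=> small; have A0 : A != fset0.
  by apply/eqP => A0; move: small; rewrite A0 cardfs0 !muln0 addn0 ltn0.
have [a1 a1A max1] := fset_argmax lam A0.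
have [a0 a0A min0] := fset_argmax (fun x => - lam x) A0.
have min a : a \in A -> lam a0 <= lam a by move=> /min0; rewrite lerN2.
(* With at most one level [small] would fail, so the top and bottom levels differ. *)
pose d := a1 - a0; have lam_d : 0 < lam d.
  rewrite (lamB lam) subr_gt0 ltNge; apply/negP => le.
  have : (m <= 1)%N.
    rewrite -(cardfs1 (lam a0)); apply: fsubset_leq_card; apply/fsubsetP=> _ /levelsP[a aA ->].
    by rewrite inE; apply/eqP/le_anti; rewrite min // andbT; apply: le_trans le; apply: max1.
  by move: small; case: m => [|[|]]; clear; card_lia.
have [Q [pi piP]] := cyclic_quotient d.
have win a : a \in A -> lam a0 <= lam a <= lam a0 + lam d.
  by move=> aA; rewrite min //= (lamB lam) addrC subrK max1.
have a0dA : a0 + d \in A by rewrite addrC subrK.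
have [K KP] := kernel_exists lam_d piP a0A.
have [p [L [lp st L1 cL]]] := lines_structure lam_d piP win a0A a0dA small KP.
exists a0, p, L, K; split=> //; split; first exact: (kernel_sg a0A KP).
by move=> k; rewrite KP => /andP[_ /eqP].
Qed.

(** * Restriction to the span of [A] *)

Section SpanSubgroup.
Variables (G : zmodType) (s : seq G).

Definition spanned : {pred G} := fun x => `[< zspan s x >].

Lemma spanned_zmod_closed : zmod_closed spanned.
Proof.
by split=> [|x y /asboolP sx /asboolP sy]; apply/asboolP; [apply: zspan0|apply: zspanB].
Qed.

HB.instance Definition _ := GRing.isZmodClosed.Build G spanned spanned_zmod_closed.

(** The separating homomorphism is additive only on the span, which is therefore made a group in its
    own right. *)
Record span_type := SpanType { span_val :> G; _ : span_val \in spanned }.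

HB.instance Definition _ := [isSub for span_val].
HB.instance Definition _ := [Choice of span_type by <:].
HB.instance Definition _ := [SubChoice_isSubZmodule of span_type by <:].

End SpanSubgroup.

Lemma torsion_separation (G : zmodType) (A : {fset G}) :
  exists (G0 : zmodType) (phi : {additive G0 -> G}) (A0 : {fset G0}) (lam : {additive G0 -> int}),
    [/\ injective phi, A = phi @` A0 &
     forall x y, x \in A0 -> y \in A0 -> lam x = lam y -> torsion (x - y)].
Proof.
pose w := [seq x - y | x <- A, y <- A].
have [|lam [lamD lam0]] := @separating_hom G A w.
  by move=> _ /allpairsP[[x y] [/= xA yA ->]]; apply: zspanB; apply: zspan_mem.
pose G0 : zmodType := span_type A.
have sval (x : G0) : zspan A (\val x) by exact: (asboolW (valP x)).
have lamB : zmod_morphism (fun x : G0 => lam (\val x)).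
  move=> x y; apply/eqP; rewrite eq_sym subr_eq; apply/eqP.
  by rewrite -lamD // raddfB subrK.
pose lam' : {additive G0 -> int} := HB.pack (fun x : G0 => lam (\val x))
  (GRing.isZmodMorphism.Build G0 int (fun x : G0 => lam (\val x)) lamB).
have lift x : x \in A -> exists y : G0, \val y = x.
  move=> xA; have xs : x \in spanned A := asboolT (zspan_mem xA).
  by exists (SpanType xs).
(* The default [0] is never taken, as every element of [A] lies in the span. *)
pose A0 : {fset G0} := [fset insubd (0 : G0) x | x in A].
have inA0 y : (y \in A0) = (\val y \in A).
  apply/imfsetP/idP => [[x /= xA ->]|yA]; last by exists (\val y); rewrite //= valKd.
  by have [z zx] := lift x xA; rewrite -zx valKd zx.
exists G0, (\val : {additive G0 -> G}), A0, lam'; split.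
- exact: val_inj.
- apply/fsetP=> x; apply/idP/imfsetP => [xA|[y /= + ->]]; last by rewrite inA0.
  by have [y yx] := lift x xA; exists y; rewrite /= ?inA0 yx.
move=> x y; rewrite !inA0 => xA yA E.
have [|e e0 xye] := lam0 (\val x - \val y) (allpairs_f _ xA yA).
  by have := lamB x y; rewrite raddfB => ->; apply/eqP; rewrite subr_eq0; apply/eqP.
by exists e => //; apply: val_inj; rewrite raddfMn raddfB raddf0.
Qed.

Lemma imfset_subgroup (G G0 : zmodType) (phi : {additive G0 -> G}) (K : {fset G0}) :
  is_subgroup K -> is_subgroup (phi @` K).
Proof.
move=> sK; split=> [|_ _ /imfsetP[x /= xK ->] /imfsetP[y /= yK ->]].
  by rewrite -(raddf0 phi) in_imfset //=; apply: sg0.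
by rewrite -raddfB in_imfset //=; apply: sgB.
Qed.

(** The finitely many torsion differences of elements of [A] lie in one finite subgroup [T], so each
    level lies in a single coset of [T]. *)
Lemma cover_by_levels (G : zmodType) (lam : {additive G -> int}) (A : {fset G}) :
  (forall x y, x \in A -> y \in A -> lam x = lam y -> torsion (x - y)) ->
  exists2 T : {fset G}, is_subgroup T & covered_by_cosets A T #|` levels lam A|.
Proof.
move=> tors; pose w := [seq z <- [seq x - y | x <- A, y <- A] | `[< torsion z >]].
have [|T sT wT] := @torsion_subgroup G w.
  by move=> z; rewrite mem_filter => /andP[/asboolP].
exists T => //.
have ex v : exists x, v \in levels lam A -> x \in A /\ lam x = v.
  by have [/levelsP[x xA ->]|] := boolP (v \in levels lam A); [exists x|exists 0].
have [f fP] := choice ex.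
exists (fun i => f (nth 0 (levels lam A) i)) => a aA.
have vA := mem_levels lam aA; have [fA lf] := fP _ vA.
have lt : (index (lam a) (levels lam A) < #|` levels lam A|)%N by rewrite index_mem.
exists (Ordinal lt); rewrite mem_coset /= nth_index //; apply: wT.
rewrite mem_filter; apply/andP; split; first by apply/asboolP; apply: tors.
exact: allpairs_f.
Qed.

Theorem theorem1 (R : realType) (G : zmodType) (A : {fset G}) (n : R)
    (n_gt0 : 0 < n)
    (A_cover : forall (K : {fset G}) (m : nat),
       is_subgroup K -> covered_by_cosets A K m -> n <= m%:R)
    (A_small : #|` sumset A A|%:R < 3 * (1 - 1 / n) * #|` A|%:R) :
  exists P K : {fset G},
    [/\ is_arith_prog P /\ (3 <= #|` P|)%N,
        is_subgroup K,
        #|` sumset P K| = (#|` P| * #|` K|)%N,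
        A `<=` sumset P K
      & (#|` P|%:R - 1) * #|` K|%:R <= #|` sumset A A|%:R - #|` A|%:R :> R].
Proof.
have [G0 [phi [A0 [lam [inj EA tors]]]]] := torsion_separation A.
pose m := #|` levels lam A0|.
have cA : #|` A| = #|` A0| by rewrite EA card_imfset.
have cAA : #|` A :+: A| = #|` A0 :+: A0| by rewrite EA -imfset_sumset card_imfset.
(* The cover by levels, carried over to [G], bounds [n] by the number of levels; [1 - 1/n] may then
   be replaced by the larger [1 - 1/m]. *)
have n_le : n <= m%:R.
  have [T sT [g gP]] := cover_by_levels tors.
  apply: (A_cover (phi @` T)); first exact: imfset_subgroup.
  exists (phi \o g) => b; rewrite EA => /imfsetP[a /= /gP[i ai] ->]; exists i.
  by move: ai; rewrite !mem_coset -raddfB /= => ai; rewrite in_imfset.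
have small : (m * #|` A0 :+: A0| + 3 * #|` A0| < 3 * m * #|` A0|)%N.
  rewrite -cA -cAA -(ltr_nat R) natrD !natrM.
  have m_gt0 : 0 < m%:R :> R by apply: lt_le_trans n_le.
  have : #|` A :+: A|%:R < 3 * (1 - 1 / m%:R) * #|` A|%:R :> R.
    apply: lt_le_trans A_small _; rewrite ler_wpM2r // ler_wpM2l // lerD2l lerN2.
    by rewrite ler_pM2l // lef_pV2.
  have E : m%:R * (3 * (1 - 1 / m%:R) * #|` A|%:R) = 3 * m%:R * #|` A|%:R - 3 * #|` A|%:R :> R.
    by field; rewrite gt_eqF.
  by move=> lt; rewrite -ltrBrDr -E ltr_pM2l.
have [c [p [L [K [[sK K0] lp st L1 cL]]]]] := rank_one_structure small.
pose P : {fset G0} := [fset c + p *+ j | j in iota 0 L.+1].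
have PP x : reflect (exists2 j, (j <= L)%N & x = c + p *+ j) (x \in P).
  apply: (iffP (imfsetP _ _ _ _)) => -[j jL ->]; exists j => //.
    by move: jL; rewrite [_ \in _]mem_iota.
  by rewrite [_ \in _]mem_iota.
have pinj i j : lam (p *+ i) = lam (p *+ j) -> i = j.
  by rewrite !raddfMn => /(mulrIn (lt0r_neq0 lp)).
(* As [lam p] is positive, the [L + 1] terms have distinct levels; since [lam] vanishes on [K], the
   same fact makes [P + K] direct below. *)
have cP : #|` P| = L.+1.
  have <- : #|` [fset j in iota 0 L.+1]| = L.+1.
    by rewrite card_fseq undup_id ?iota_uniq // size_iota.
  have -> : P = [fset c + p *+ j | j in [fset i in iota 0 L.+1]].
    by apply: eq_imfset => // i; rewrite !inE.
  by rewrite card_imfset //= => i j /addrI/(congr1 lam)/pinj.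
have sA0 : A0 `<=` P :+: K.
  apply/fsubsetP=> a /st[j jL aK]; apply/mem_sumK; exists (c + p *+ j).
    by apply/PP; exists j.
  by rewrite opprD addrA.
have cPK : #|` P :+: K| = (#|` P| * #|` K|)%N.
  apply: card_imfset2_inj => x x' y y' /PP[i _ ->] /PP[j _ ->] yK y'K E.
  have ij : i = j.
    apply: pinj; have := congr1 lam E; rewrite !(raddfD lam) (K0 _ yK) (K0 _ y'K) !addr0.
    exact: addrI.
  by split; [rewrite ij|move: E; rewrite ij => /addrI].
have cphi (X : {fset G0}) : #|` phi @` X| = #|` X| by apply: card_imfset.
exists (phi @` P), (phi @` K); rewrite -imfset_sumset !cphi cPK cP cA cAA; split=> //.
- split; last by rewrite !ltnS.
  exists (phi c), (phi p), L; apply/fsetP=> x; apply/imfsetP/imfsetP.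
    move=> [_ /PP[j jL ->] ->]; exists j; first by rewrite [_ \in _]mem_iota.
    by rewrite raddfD raddfMn.
  move=> [j]; rewrite [_ \in _]mem_iota => jL ->; exists (c + p *+ j).
    by apply/PP; exists j.
  by rewrite raddfD raddfMn.
- exact: imfset_subgroup.
- by rewrite EA; apply/fsubsetP=> _ /imfsetP[a /= /(fsubsetP sA0) aPK ->]; rewrite in_imfset.
by rewrite -natr1 addrK lerBrDr -natrM -natrD ler_nat.
Qed.
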